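(* Let $A$ be a semisimple Banach algebra and let $a,b\in\mathrm{Soc}(A)$. If $\rho(a,b)=0$, then $m(\lambda,a)=m(\lambda,b)$ for each $\lambda\in\sigma'(a)=\sigma'(b)$.
   Context: Banach algebras are over $\mathbb{C}$ and have a unit $1$; $\sigma(x)$ is the spectrum of $x\in A$ and $\sigma'(x)=\sigma(x)\setminus\{0\}$. For $a,b\in A$ let $C_{a,b}:A\to A$ be the bounded operator $C_{a,b}x=ax-xb$, and put $\rho(a,b)=\limsup_{n\to\infty}\|C_{a,b}^n1\|^{1/n}$. $\mathrm{Soc}(A)$ (the socle) is the two-sided ideal of all finite sums of rank one elements, where $0\neq u\in A$ is rank one if $uAu\subseteq\mathbb{C}u$ (the zero element is included as the empty sum); every element of $\mathrm{Soc}(A)$ has finite spectrum. For $a\in A$ let $\mathrm{rank}(a)=\sup_{x\in A}\#\sigma'(xa)\le\infty$, where $\#K$ is the number of distinct elements of $K\subseteq\mathbb{C}$. For $a\in\mathrm{Soc}(A)$ the rank is finite and $E(a)=\{x\in A:\#\sigma'(xa)=\mathrm{rank}(a)\}$ is open and dense in $A$. Multiplicity (Aupetit–Mouton): for $a\in\mathrm{Soc}(A)$ and $\lambda\in\sigma(a)$, let $V_\lambda$ be an open disk centered at $\lambda$ whose closure contains no other point of $\sigma(a)$. There is an open ball $U\subset A$ centered at $1$ such that $\#[\sigma(xa)\cap V_\lambda]$ is constant for $x\in E(a)\cap U$; this constant is the multiplicity $m(\lambda,a)$ of $a$ at $\lambda$. *)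

(* Defs.v *)
From HB Require Import structures.
From mathcomp Require Import all_boot all_order all_algebra.
From mathcomp Require Import complex.
From mathcomp Require Import all_classical all_reals all_analysis.

Set Implicit Arguments.
Unset Strict Implicit.
Unset Printing Implicit Defensive.

Import Order.TTheory GRing.Theory Num.Theory.
Import numFieldNormedType.Exports.

Local Open Scope classical_set_scope.
Local Open Scope ring_scope.
Local Open Scope complex_scope.

(* Hierarchy-Builder rejects the join of normed modules with rings, because    *)
(* numDomainType already inherits from both. The product is therefore part of *)
(* the mixin, and the unitAlgType structure on the carrier is attached by the *)
(* instances below. The normalization `|1| = 1 is not imposed.                *)
HB.mixin Record isBanachAlgebra (K : numFieldType) A
    of CompleteNormedModule K A := {
  banach_one : A;
  banach_mul : A -> A -> A;
  banach_mulA : associative banach_mul;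
  banach_mul1x : left_id banach_one banach_mul;
  banach_mulx1 : right_id banach_one banach_mul;
  banach_mulDl : left_distributive banach_mul +%R;
  banach_mulDr : right_distributive banach_mul +%R;
  banach_oner_neq0 : banach_one != 0;
  banach_scalerAl : forall (k : K) (x y : A),
    k *: banach_mul x y = banach_mul (k *: x) y;
  banach_scalerAr : forall (k : K) (x y : A),
    k *: banach_mul x y = banach_mul x (k *: y);
  banach_normM : forall x y : A, `|banach_mul x y| <= `|x| * `|y|
}.

#[short(type="banachAlgType")]
HB.structure Definition BanachAlgebra (K : numFieldType) :=
  {A of CompleteNormedModule K A & isBanachAlgebra K A}.

#[non_forgetful_inheritance]
HB.instance Definition _ (K : numFieldType) (A : banachAlgType K) :=
  GRing.Zmodule_isNzRing.Build A (@banach_mulA K A) (@banach_mul1x K A)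
    (@banach_mulx1 K A) (@banach_mulDl K A) (@banach_mulDr K A)
    (@banach_oner_neq0 K A).

#[non_forgetful_inheritance]
HB.instance Definition _ (K : numFieldType) (A : banachAlgType K) :=
  GRing.LSemiModule_isLSemiAlgebra.Build K A (@banach_scalerAl K A).

#[non_forgetful_inheritance]
HB.instance Definition _ (K : numFieldType) (A : banachAlgType K) :=
  GRing.LSemiAlgebra_isSemiAlgebra.Build K A (@banach_scalerAr K A).


Section BanachInverse.
Variables (K : numFieldType) (A : banachAlgType K).

Let inverse_of (x : A) : set A := [set y | y * x = 1 /\ x * y = 1].

Definition banach_unit : pred A := fun x => `[< inverse_of x !=set0 >].

Definition banach_inv (x : A) : A := xget x (inverse_of x).

Fact banach_mulVx : {in banach_unit, left_inverse 1 banach_inv *%R}.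
Proof. by move=> x /asboolP[y /(xgetI x)[]]. Qed.

Fact banach_mulxV : {in banach_unit, right_inverse 1 banach_inv *%R}.
Proof. by move=> x /asboolP[y /(xgetI x)[]]. Qed.

Fact banach_unitP (x y : A) : y * x = 1 /\ x * y = 1 -> banach_unit x.
Proof. by move=> xy1; apply/asboolP; exists y. Qed.

Fact banach_inv_out : {in [predC banach_unit], banach_inv =1 id}.
Proof.
move=> x /negP ux; rewrite /banach_inv xgetPN// => y xy1.
by apply: ux; apply/asboolP; exists y.
Qed.

End BanachInverse.

#[non_forgetful_inheritance]
HB.instance Definition _ (K : numFieldType) (A : banachAlgType K) :=
  GRing.NzRing_hasMulInverse.Build A (@banach_mulVx K A) (@banach_mulxV K A)
    (@banach_unitP K A) (@banach_inv_out K A).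

(* R[i] itself carries no topology in the library, but every numFieldType     *)
(* does: writing the complex field as Cplx R makes ball and closure available. *)
Definition Cplx (R : realType) : numFieldType := R[i].

Section Semisimple.
Variables (K : numFieldType) (A : banachAlgType K).

(* idealr_closed: proper, and closed under u, v |-> a * u + v, i.e. a proper   *)
(* left ideal.                                                                *)
Definition maximal_left_ideal (I : {pred A}) :=
  idealr_closed I /\
  forall J : {pred A}, idealr_closed J -> {subset I <= J} -> {subset J <= I}.

Definition jacobson_radical : set A :=
  [set x | forall I : {pred A}, maximal_left_ideal I -> x \in I].

Definition semisimple := jacobson_radical = [set 0].

End Semisimple.

Arguments semisimple {K} A.

Section Spectrum.
Variables (K : numFieldType) (A : banachAlgType K).

Definition spectrum (x : A) : set K :=
  [set z | z%:A - x \isn't a GRing.unit].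

Definition nzspectrum (x : A) : set K := spectrum x `\ 0.

Definition rank_one (u : A) :=
  u != 0 /\ forall x, exists c : K, u * x * u = c *: u.

Definition socle : set A :=
  [set a | exists2 s : seq A,
     forall u, u \in s -> rank_one u & a = \sum_(u <- s) u].

Definition Cop (a b x : A) : A := a * x - x * b.

End Spectrum.

Section Multiplicity.
Variables (R : realType) (A : banachAlgType (Cplx R)).

(* Norms are elements of R[i] with zero imaginary part, whence Re. The 0-th    *)
(* term (exponent 0^-1 = 0) is irrelevant to the limsup.                      *)
Definition rho (a b : A) : \bar R :=
  limn_esup (fun n =>
    (complex.Re `|iter n (Cop a b) 1| `^ (n%:R^-1))%:E).

Definition rank (a : A) : \bar R :=
  ereal_sup [set counting (nzspectrum (x * a)) | x in [set: A]].

Definition Eset (a : A) : set A :=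
  [set x | counting (nzspectrum (x * a)) = rank a].

Definition is_multiplicity (l : Cplx R) (a : A) (n : nat) :=
  forall r : Cplx R, 0 < r ->
    closure (ball l r) `&` spectrum a `<=` [set l] ->
    exists2 e : Cplx R, 0 < e &
      forall x, (Eset a `&` ball (1 : A) e) x ->
        counting (spectrum (x * a) `&` ball l r) = n%:R%:E :> \bar R.

(* Meaningful for a in the socle and l in the spectrum of a, where the value  *)
(* exists and is unique; elsewhere it may be a junk value.                    *)
Definition multiplicity (l : Cplx R) (a : A) : nat :=
  get (is_multiplicity l a).

End Multiplicity.

(* Main.v *)
Require Import Defs.
From mathcomp Require Import all_boot all_order all_algebra.
From mathcomp Require Import complex.
From mathcomp Require Import separable.
From mathcomp Require Import finmap ring.
From mathcomp Require Import all_classical all_reals all_analysis.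
Set Implicit Arguments.
Unset Strict Implicit.
Unset Printing Implicit Defensive.
Import Order.TTheory GRing.Theory Num.Theory.
Import numFieldNormedType.Exports.
Local Open Scope classical_set_scope.
Local Open Scope ring_scope.

(** The proof has two halves: the vanishing of rho makes the spectral
    idempotents of a and b coincide, and multiplicities of a socle element are
    algebraic multiplicities of eigenvalues of a finite matrix, which the
    spectral idempotent determines.

    Equality of idempotents. Elements of the socle are algebraic: they are
    annihilated by nonzero complex polynomials. If u commutes with a and v with
    b, then C^n (u v) = u (C^n 1) v for C = C_(a,b), so rho(a,b) = 0 prevents
    u v from being an eigenvector of C for a nonzero eigenvalue
    (rho0_no_eigen). Peeling off linear factors one at a time, this gives
    u v = 0 as soon as P(a) u = 0 and Q(b) v = 0 for polynomials P, Q without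
    common root (horner_alg_disjoint_mul). Let f be a polynomial that is
    congruent to the spectral idempotent at l both modulo an annihilator of a
    and modulo one of b. Then f(a) (1 - f)(b) = 0 = (1 - f)(a) f(b), so
    f(a) = f(b) (spectral_idempotent_eq).

    Reduction to matrices. Semisimplicity makes A semiprime, so every rank one
    element factors through a minimal idempotent; finitely many of them factor
    through a common finite family E of pairwise orthogonal (inequivalent)
    minimal idempotents (orthogonal_idempotents_cover). All the corners r A r'
    with r, r' in E are at most one-dimensional and a single linear functional
    phi reads off their coordinates (frame_exists). A socle element is thus a
    sum of products al_i be_i with al_i in A r_i and be_i in r_i A, and the
    nonzero spectrum of x a is that of the matrix gram x with entries
    phi(be_i x al_j) (spectrum_gramP), just as the matrices U V and V U have the
    same nonzero eigenvalues.

    Multiplicities. Take such a decomposition with the least number n of terms.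
    Then gram x can be made any diagonal matrix (gram_diag), so the rank of a is
    n and E(a) consists of the x for which gram x has n distinct nonzero
    eigenvalues (Eset_gram). By continuity of roots, for x near 1 the number of
    these eigenvalues in an isolating disk at l is the algebraic multiplicity of
    l for gram 1 (is_multiplicity_gram); it is the only possible value because
    E(a) accumulates at 1, the condition for belonging to it being the
    nonvanishing of a polynomial (is_multiplicity_unique).

    Comparison. The algebraic multiplicity of l for gram 1 is the trace of
    f(gram 1), a Gram matrix of the idempotent f(a) (trace_spectral_idempotent).
    Two decompositions of the same element p have matrices gram p of the form
    X Y and Y X, hence of equal trace (trace_gram_unique). As f(a) = f(b), the
    multiplicities agree (count_roots_eq). *)

(** * Traces and spectral idempotents of complex matrices *)

Section PolyMatrix.
Variable C : numClosedFieldType.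
Implicit Types (s t : seq C) (p q : {poly C}).

Lemma char_poly_conjmx n (P M : 'M[C]_n) :
  P \in unitmx -> char_poly (conjmx P M) = char_poly M.
Proof.
move=> uP; rewrite conjumx // /char_poly /char_poly_mx.
have PV : map_mx polyC P *m map_mx polyC (invmx P) = 1%:M.
  by rewrite -map_mxM /= mulmxV // map_mx1.
have -> : 'X%:M - map_mx polyC (P *m M *m invmx P) =
    map_mx polyC P *m ('X%:M - map_mx polyC M) *m map_mx polyC (invmx P).
  rewrite mulmxBr mulmxBl !map_mxM /= scalar_mxC -(mulmxA _%:M) PV mulmx1.
  by [].
by rewrite !det_mulmx mulrAC -det_mulmx PV det1 mul1r.
Qed.

Lemma trig_mulmx n (S T : 'M[C]_n) :
  is_trig_mx S -> is_trig_mx T ->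
  is_trig_mx (S *m T) /\ forall i, (S *m T) i i = S i i * T i i.
Proof.
move=> /is_trig_mxP tS /is_trig_mxP tT; split.
  apply/is_trig_mxP => i j ij; rewrite mxE big1 // => k _.
  case: (ltnP i k) => [/tS->|ki]; first by rewrite mul0r.
  by rewrite tT ?mulr0 // (leq_ltn_trans ki).
move=> i; rewrite mxE (bigD1 i) //= big1 ?addr0 // => k ki.
case: (ltngtP i k) => [/tS->|/tT->|/val_inj ik]; rewrite ?mul0r ?mulr0 //.
by rewrite ik eqxx in ki.
Qed.

Lemma trig_horner_mx n (T : 'M[C]_n.+1) p :
  is_trig_mx T ->
  is_trig_mx (horner_mx T p) /\ forall i, horner_mx T p i i = p.[T i i].
Proof.
move=> tT; elim/poly_ind: p => [|p c [IHt IHd]].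
  by rewrite rmorph0; split=> [|i]; rewrite ?mx0_is_trig // mxE horner0.
rewrite rmorphD rmorphM /= horner_mx_X horner_mx_C.
have [tM dM] := trig_mulmx IHt tT; split.
  apply/is_trig_mxP => i j ij; rewrite mxE (is_trig_mxP tM) //.
  by rewrite (is_trig_mxP (scalar_mx_is_trig _ _)) // addr0.
by move=> i; rewrite !hornerE mxE dM IHd mxE eqxx mulr1n.
Qed.

(** Schur triangularization reduces this to a triangular matrix, whose diagonal
    lists the roots of the characteristic polynomial. *)
Lemma trace_horner_mx n (M : 'M[C]_n.+1) s p :
  char_poly M = \prod_(z <- s) ('X - z%:P) ->
  \tr (horner_mx M p) = \sum_(z <- s) p.[z].
Proof.
move=> Ms; have [P /unitarymx_unit uP tM] := Schur M (ltn0Sn n).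
have : char_poly (conjmx P M) = \prod_(z <- s) ('X - z%:P).
  by rewrite char_poly_conjmx.
rewrite char_poly_trig // -(big_map (fun i => conjmx P M i i) xpredT
  (fun z => 'X - z%:P)) => /prod_XsubC_eq ps.
rewrite -(perm_big _ ps) /= big_map.
have <- : \tr (horner_mx (conjmx P M) p) = \tr (horner_mx M p).
  rewrite conjumx // horner_mx_uconj // mxtrace_mulC mulmxA mulVmx //.
  by rewrite mul1mx.
by apply: eq_bigr => i _; have [_ ->] := trig_horner_mx p tM.
Qed.

(** By the Chinese remainder theorem there is a polynomial congruent to 0
    modulo the factors of P away from l and to 1 modulo the powers of X - l in
    P: it evaluates to the spectral idempotent at l on anything killed by P. *)
Lemma spectral_poly s (l : C) :
  exists f, [/\ \prod_(z <- s) ('X - z%:P) %|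
                  f * \prod_(z <- s | z == l) ('X - z%:P),
                \prod_(z <- s) ('X - z%:P) %|
                  (1 - f) * \prod_(z <- s | z != l) ('X - z%:P) &
                \prod_(z <- s) ('X - z%:P) %| f * (1 - f)].
Proof.
set P := \prod_(z <- s) _; set Q1 := \prod_(z <- s | z == l) _.
set Q2 := \prod_(z <- s | z != l) _.
have PE : P = Q1 * Q2 by rewrite /P (bigID (fun z => z == l)).
have /Bezout_eq1_coprimepP[[u v] /= uv] : coprimep Q1 Q2.
  rewrite /Q1; elim/big_rec: _ => [|z q /eqP-> cq]; first by rewrite coprime1p.
  rewrite coprimepMl cq andbT coprimep_sym coprimep_XsubC.
  rewrite /Q2 -big_filter root_prod_XsubC mem_filter eqxx //.
exists (v * Q2).
have -> : 1 - v * Q2 = u * Q1 by rewrite -uv addrK.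
by rewrite PE; split; apply/dvdpP; [exists v|exists u|exists (v * u)]; ring.
Qed.

Lemma spectral_poly_eval s (l : C) f z :
  \prod_(z <- s) ('X - z%:P) %| f * \prod_(z <- s | z == l) ('X - z%:P) ->
  \prod_(z <- s) ('X - z%:P) %| (1 - f) * \prod_(z <- s | z != l) ('X - z%:P) ->
  z \in s -> f.[z] = (z == l)%:R.
Proof.
move=> d1 d2 zs.
have r0 : root (\prod_(z <- s) ('X - z%:P)) z by rewrite root_prod_XsubC.
have [zl|zl] := eqVneq z l.
  have := root_dvdp d2 r0; rewrite rootM -big_filter root_prod_XsubC.
  rewrite mem_filter zl eqxx /= orbF rootE !hornerE subr_eq0.
  by move/eqP <-.
have := root_dvdp d1 r0; rewrite rootM -big_filter root_prod_XsubC.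
by rewrite mem_filter (negbTE zl) /= orbF => /rootP.
Qed.

End PolyMatrix.

(** * Intertwining of spectral idempotents *)

(** The consequence of rho(a,b) = 0 that the algebra uses: C_(a,b) has no
    nonzero eigenvalue on products of elements of the commutants of a and of b.
    *)
Definition no_product_eigenvector (C : numClosedFieldType) (A : banachAlgType C)
    (a b : A) :=
  forall (u v : A) (g : C), g != 0 -> GRing.comm a u -> GRing.comm b v ->
    Cop a b (u * v) = g *: (u * v) -> u * v = 0.

Section Intertwine.
Variables (C : numClosedFieldType) (A : banachAlgType C) (a b : A).
Hypothesis no_eigen : no_product_eigenvector a b.

Lemma horner_alg_prod_cons (x : A) (z : C) (s : seq C) :
  horner_alg x (\prod_(y <- z :: s) ('X - y%:P)) =
  horner_alg x (\prod_(y <- s) ('X - y%:P)) * (x - z%:A).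
Proof.
by rewrite big_cons mulrC rmorphM rmorphB /= horner_algX horner_algC.
Qed.

Lemma comm_subrA (x : A) (z : C) : GRing.comm x (x - z%:A).
Proof. by rewrite /GRing.comm mulrBr mulrBl -scalerAl -scalerAr mul1r mulr1. Qed.

(** Induction on the two lists of roots. Multiplying u by a - l, or v by b - m,
    shortens a list, so both products vanish by induction; then a u v = l u v
    and u v b = m u v, and u v is an eigenvector of C_(a,b) for l - m, which is
    not 0. *)
Lemma horner_alg_disjoint_mul (s t : seq C) (u v : A) :
  {in s, forall z, z \notin t} -> GRing.comm a u -> GRing.comm b v ->
  horner_alg a (\prod_(z <- s) ('X - z%:P)) * u = 0 ->
  horner_alg b (\prod_(z <- t) ('X - z%:P)) * v = 0 -> u * v = 0.
Proof.
elim: s u => [|l s IHs] u in t v *.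
  by rewrite big_nil rmorph1 mul1r => _ _ _ -> _; rewrite mul0r.
elim: t v => [|m t IHt] v st cu cv.
  by rewrite big_nil rmorph1 mul1r => _ ->; rewrite mulr0.
rewrite horner_alg_prod_cons -mulrA => ua.
have cul : GRing.comm a ((a - l%:A) * u).
  by apply: commrM => //; exact: comm_subrA.
rewrite horner_alg_prod_cons -mulrA => vb.
have cvm : GRing.comm b ((b - m%:A) * v).
  by apply: commrM => //; exact: comm_subrA.
have left0 : (a - l%:A) * u * v = 0.
  apply: (IHs _ (m :: t)) => //.
    by move=> z zs; apply: st; rewrite inE zs orbT.
  by rewrite horner_alg_prod_cons -mulrA.
have right0 : u * ((b - m%:A) * v) = 0.
  apply: IHt => //; last by rewrite horner_alg_prod_cons -mulrA.
  by move=> z /st; rewrite inE negb_or => /andP[].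
have lm : l != m by have := st l; rewrite !inE eqxx negb_or => /(_ isT)/andP[].
apply: (@no_eigen _ _ (l - m)) => //; first by rewrite subr_eq0.
have avE : a * (u * v) = l *: (u * v).
  apply/eqP; rewrite -subr_eq0 -left0 !mulrBl -scalerAl mul1r -scalerAl.
  by rewrite mulrA.
have bvE : u * v * b = m *: (u * v).
  apply/eqP; rewrite -subr_eq0 -right0 mulrBl mulrBr cv -scalerAl mul1r.
  by rewrite -scalerAr mulrA.
by rewrite /Cop avE bvE scalerBl.
Qed.

(** Both f(a) (1 - f)(b) and (1 - f)(a) f(b) vanish, since f only sees the root
    l and 1 - f only the other ones; hence f(a) = f(a) f(b) = f(b). *)
Lemma spectral_idempotent_eq (s : seq C) (l : C) (f : {poly C}) :
  horner_alg a (\prod_(z <- s) ('X - z%:P)) = 0 ->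
  horner_alg b (\prod_(z <- s) ('X - z%:P)) = 0 ->
  \prod_(z <- s) ('X - z%:P) %| f * \prod_(z <- s | z == l) ('X - z%:P) ->
  \prod_(z <- s) ('X - z%:P) %| (1 - f) * \prod_(z <- s | z != l) ('X - z%:P) ->
  horner_alg a f = horner_alg b f.
Proof.
set P := \prod_(z <- s) _ => aP bP.
have ann x q : horner_alg x P = 0 -> P %| q -> horner_alg x q = 0.
  by move=> xP /dvdpP[r ->]; rewrite rmorphM /= xP mulr0.
have comx (x : A) q : GRing.comm x (horner_alg x q).
  rewrite /GRing.comm -[X in X * _ = _](horner_algX x).
  by rewrite -[X in _ = _ * X](horner_algX x) -!rmorphM mulrC.
rewrite -big_filter => d1; rewrite -big_filter => d2.
have d1a : P %| \prod_(z <- [seq z <- s | z == l]) ('X - z%:P) * f.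
  by rewrite mulrC.
have d2a : P %| \prod_(z <- [seq z <- s | z != l]) ('X - z%:P) * (1 - f).
  by rewrite mulrC.
have disj : {in [seq z <- s | z == l], forall z, z \notin [seq z <- s | z != l]}.
  by move=> z; rewrite !mem_filter => /andP[-> _].
have disj' : {in [seq z <- s | z != l], forall z, z \notin [seq z <- s | z == l]}.
  by move=> z; rewrite !mem_filter => /andP[/negbTE-> _].
have e1 : horner_alg a f * horner_alg b (1 - f) = 0.
  by apply: (horner_alg_disjoint_mul disj) => //; rewrite -rmorphM; exact: ann.
have e2 : horner_alg a (1 - f) * horner_alg b f = 0.
  by apply: (horner_alg_disjoint_mul disj') => //; rewrite -rmorphM; exact: ann.
move: e1 e2; rewrite !rmorphB !rmorph1 mulrBr mulr1 mulrBl mul1r.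
by move=> /eqP; rewrite subr_eq0 => /eqP -> /eqP; rewrite subr_eq0 => /eqP ->.
Qed.

End Intertwine.

Section Rho.
Variables (R : realType) (A : banachAlgType (Cplx R)) (a b : A).

Lemma Re_normK (V : normedZmodType (Cplx R)) (x : V) :
  (complex.Re `|x|)%:C%C = `|x| :> R[i].
Proof. by rewrite RRe_real // normr_real. Qed.

Lemma rho_decay : rho a b = 0%E -> forall eps : R, 0 < eps ->
  \forall n \near \oo, complex.Re `|iter n (Cop a b) 1| <= eps ^+ n.
Proof.
rewrite /rho /limn_esup limf_esupE => inf0 eps eps0.
have : (ereal_inf [set ereal_sup [set
    (complex.Re `|iter n (Cop a b) 1| `^ n%:R^-1)%:E | n in V] | V in \oo] <
    eps%:E)%E by rewrite inf0 lte_fin.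
move=> /ereal_inf_lt[_ [V [m _ mV] <-]] Veps.
exists m.+1 => // n /= mn.
have n0 : (0 < n)%N by rewrite (leq_ltn_trans _ mn).
have : ((complex.Re `|iter n (Cop a b) 1| `^ n%:R^-1)%:E <= eps%:E)%E.
  apply: le_trans (ltW Veps); apply: ereal_sup_ubound; exists n => //.
  by apply: mV; rewrite /= ltnW.
rewrite lee_fin => le1.
have N0 : 0 <= complex.Re `|iter n (Cop a b) 1|.
  have : 0 <= `|iter n (Cop a b) 1| by [].
  by rewrite lecE => /andP[].
have := lerXn2r n _ _ le1; rewrite !nnegrE powR_ge0 ltW // => /(_ isT isT).
by rewrite -(powR_mulrn n (powR_ge0 _ _)) -powRrM mulVf ?pnatr_eq0 -?lt0n // powRr1.
Qed.

Lemma iter_Cop_mul n (u v : A) : GRing.comm a u -> GRing.comm b v ->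
  iter n (Cop a b) (u * v) = u * iter n (Cop a b) 1 * v.
Proof.
move=> cu cv; elim: n => [|n IHn]; first by rewrite mulr1.
rewrite !iterS IHn /Cop mulrBr mulrBl !mulrA cu; congr (_ - _).
by rewrite -!mulrA cv.
Qed.

(** On an eigenvector y = u v of eigenvalue g, C^n y = g^n y = u (C^n 1) v, so
    that |g|^n |y| is at most |u| |v| |C^n 1|, which is eventually smaller than
    |u| |v| (|g|/2)^n. *)
Lemma rho0_no_eigen : rho a b = 0%E -> @no_product_eigenvector R[i] A a b.
Proof.
move=> rho0 u v g g0 cu cv ge; set y := u * v.
have iterE n : iter n (Cop a b) y = g ^+ n *: y.
  elim: n => [|n IHn]; first by rewrite scale1r.
  rewrite iterS IHn /Cop -scalerAr -scalerAl -scalerBr.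
  by rewrite -[_ - _]/(Cop a b y) ge scalerA exprSr.
have bound n : `|g| ^+ n * `|y| <= `|u| * `|v| * `|iter n (Cop a b) 1|.
  rewrite -normrX -normrZ -iterE iter_Cop_mul // mulrAC.
  apply: le_trans (banach_normM _ _) _; rewrite ler_wpM2r //.
  exact: banach_normM.
pose G := complex.Re `|g|; pose Y := complex.Re `|y|.
pose K := complex.Re `|u| * complex.Re `|v|.
have boundR n : G ^+ n * Y <= K * complex.Re `|iter n (Cop a b) 1|.
  by rewrite /G /Y /K -lecR !rmorphM rmorphXn /= !Re_normK.
have G0 : 0 < G by have := normr_gt0 g; rewrite g0 -Re_normK ltcR.
apply/eqP; rewrite -normr_le0 -Re_normK lecR leNgt; apply/negP => Y0.
have K0 : 0 <= K.
  by apply: mulr_ge0; rewrite -lecR Re_normK; exact: normr_ge0.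
have [N _ decay] := rho_decay rho0 (divr_gt0 G0 (ltr0Sn R 1)).
have [m mN Km] : exists2 m, (N <= m)%N & K < Y * 2 ^+ m.
(* 2 ^ k exceeds k, which exceeds K / Y. *)
  pose k := Num.bound (K / Y); exists (N + k)%N; first exact: leq_addr.
  rewrite mulrC -ltr_pdivrMr //; apply: lt_le_trans (archi_boundP _) _.
    by rewrite divr_ge0 // ltW.
  rewrite -natrX ler_nat; apply: leq_trans (ltnW (ltn_expl k (ltnSn 1))) _.
  by rewrite leq_exp2l // leq_addl.
have := le_trans (boundR m) (ler_wpM2l K0 (decay m mN)).
rewrite expr_div_n mulrA ler_pdivlMr ?exprn_gt0 // -mulrA mulrC.
by rewrite ler_pM2r ?exprn_gt0 // leNgt Km.
Qed.
End Rho.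

(** * Continuity of roots and density of simple spectra *)

Section RootContinuity.
Variables (C : numClosedFieldType) (T : Type) (F : set_system T).
Context {FF : Filter F}.

Definition coef_cvg (q : T -> {poly C}) (p : {poly C}) :=
  forall k, (q x)`_k @[x --> F] --> (p`_k : C).

Lemma coef_cvg_cst p : coef_cvg (fun=> p) p.
Proof. by move=> k; exact: cvg_cst. Qed.

Lemma coef_cvgD q1 q2 p1 p2 : coef_cvg q1 p1 -> coef_cvg q2 p2 ->
  coef_cvg (fun x => q1 x + q2 x) (p1 + p2).
Proof.
move=> h1 h2 k; rewrite coefD.
by under eq_fun do rewrite coefD; apply: cvgD.
Qed.

Lemma cvg_sum_fin (I : Type) (r : seq I) (f : I -> T -> C) (l : I -> C) :
  (forall i, f i x @[x --> F] --> l i) ->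
  \sum_(i <- r) f i x @[x --> F] --> \sum_(i <- r) l i.
Proof.
move=> fl; elim: r => [|i r IHr].
  by rewrite big_nil; under eq_fun do rewrite big_nil; exact: cvg_cst.
by rewrite big_cons; under eq_fun do rewrite big_cons; apply: cvgD.
Qed.

Lemma coef_cvgM q1 q2 p1 p2 : coef_cvg q1 p1 -> coef_cvg q2 p2 ->
  coef_cvg (fun x => q1 x * q2 x) (p1 * p2).
Proof.
move=> h1 h2 k; rewrite coefM.
under eq_fun do rewrite coefM.
by apply: cvg_sum_fin => i; apply: cvgM; [exact: h1|exact: h2].
Qed.

Lemma coef_cvg_char_poly n (M : T -> 'M[C]_n) (N : 'M[C]_n) :
  (forall i j, M x i j @[x --> F] --> N i j) ->
  coef_cvg (fun x => char_poly (M x)) (char_poly N).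
Proof.
move=> MN; rewrite /char_poly /determinant.
have entry i j : coef_cvg (fun x => char_poly_mx (M x) i j) (char_poly_mx N i j).
  move=> k; rewrite !mxE coefB coefC.
  under eq_fun do rewrite !mxE coefB coefC.
  apply: cvgB; first exact: cvg_cst.
  by case: (k == 0)%N; [exact: MN|exact: cvg_cst].
elim: (index_enum _) => [|s r IHr].
  by under eq_fun do rewrite big_nil; rewrite big_nil; exact: coef_cvg_cst.
under eq_fun do rewrite big_cons; rewrite big_cons; apply: coef_cvgD => //.
apply: coef_cvgM; first exact: coef_cvg_cst.
elim: (index_enum _) => [|i r' IHr'].
  by under eq_fun do rewrite big_nil; rewrite big_nil; exact: coef_cvg_cst.
by under eq_fun do rewrite big_cons; rewrite big_cons; apply: coef_cvgM.
Qed.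

(** The distances from m to the roots multiply to the absolute value at m, so
    the closest root has at most their geometric mean as distance. *)
Lemma close_root (s : seq C) (m : C) : s != [::] ->
  exists2 z, z \in s & `|m - z| ^+ size s <= `|(\prod_(z <- s) ('X - z%:P)).[m]|.
Proof.
elim: s => [//|z s IHs] _; have [->|/IHs[w ws wle]] := eqVneq s [::].
  by exists z; rewrite ?mem_head // big_seq1 expr1 hornerXsubC.
rewrite big_cons hornerM hornerXsubC normrM /=.
have /orP[zw|wz] : (`|m - z| <= `|m - w|) || (`|m - w| <= `|m - z|).
  exact: real_leVge (normr_real _) (normr_real _).
- exists z; rewrite ?mem_head // exprS ler_wpM2l //.
  by apply: le_trans wle; rewrite lerXn2r.
- exists w; first by rewrite inE ws orbT.
  by rewrite exprS ler_pM // exprn_ge0.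
Qed.

Lemma horner_cvg q p n (m : C) : coef_cvg q p -> (forall x, size (q x) = n) ->
  size p = n -> (q x).[m] @[x --> F] --> p.[m].
Proof.
move=> qp sq sp; rewrite horner_coef sp.
under eq_fun do rewrite horner_coef sq.
by apply: cvg_sum_fin => i; apply: cvgM; [exact: qp|exact: cvg_cst].
Qed.

(** The coefficients of the quotient by X - z are computed from the top one
    down by the recurrence of synthetic division, which is continuous in z. *)
Lemma coef_cvg_divXsubC n (q1 : T -> {poly C}) (p1 : {poly C}) (nu : T -> C) (m : C) :
  nu x @[x --> F] --> m ->
  (forall x, (size (q1 x) <= n)%N) -> (size p1 <= n)%N ->
  coef_cvg (fun x => ('X - (nu x)%:P) * q1 x) (('X - m%:P) * p1) ->
  coef_cvg q1 p1.
Proof.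
move=> num sq1 sp1 qp k.
have [j] : exists j, (n <= k + j)%N by exists n; rewrite leq_addl.
elim: j k => [|j IHj] k nkj.
  rewrite addn0 in nkj; rewrite nth_default; last exact: leq_trans sp1 nkj.
  rewrite (_ : (fun x => (q1 x)`_k) = fun=> 0); first exact: cvg_cst.
  by apply/funext => x; rewrite nth_default // (leq_trans (sq1 x) nkj).
have rec (q : {poly C}) z : q`_k = (('X - z%:P) * q)`_k.+1 + z * q`_k.+1.
  by rewrite mulrBl coefB coefXM coefCM subrK.
rewrite (rec p1 m); under eq_fun => x do rewrite (rec (q1 x) (nu x)).
apply: cvgD; first exact: qp.
by apply: cvgM => //; apply: IHj; rewrite addSnnS.
Qed.

(** Induction on the degree: the root of the moving polynomial nearest to a
    root m of the limit converges to m by close_root, and dividing both out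
    preserves the convergence of coefficients. *)
Lemma roots_cvg (s0 : seq C) (s : T -> seq C) :
  (forall x, size (s x) = size s0) ->
  coef_cvg (fun x => \prod_(z <- s x) ('X - z%:P)) (\prod_(z <- s0) ('X - z%:P)) ->
  exists2 t : T -> seq C, forall x, perm_eq (t x) (s x) &
    forall i, (i < size s0)%N -> nth 0 (t x) i @[x --> F] --> nth 0 s0 i.
Proof.
elim: s0 s => [|m s0 IHs] s ss sp; first by exists s.
have near_root x : exists nu, nu \in s x /\
    `|m - nu| ^+ (size s0).+1 <= `|(\prod_(z <- s x) ('X - z%:P)).[m]|.
  have := @close_root (s x) m.
  by rewrite ss -size_eq0 ss => /(_ isT)[z]; exists z.
have [nu nuP] := choice near_root.
have num : nu x @[x --> F] --> m.
  apply/cvgrPdist_lt => e e0.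
  have : (\prod_(z <- s x) ('X - z%:P)).[m] @[x --> F] --> (0 : C).
    have <- : (\prod_(z <- m :: s0) ('X - z%:P)).[m] = 0.
      by rewrite big_cons hornerM hornerXsubC subrr mul0r.
    by apply: (horner_cvg (n := (size s0).+2)) => // [x|];
      rewrite size_prod_XsubC ?ss.
  move=> /cvgrPdist_lt/(_ _ (exprn_gt0 (size s0).+1 e0)).
  apply: filterS => x; rewrite sub0r normrN => small.
  have := le_lt_trans (nuP x).2 small.
  by rewrite ltr_pXn2r // nnegrE ltW.
have sE x : perm_eq (s x) (nu x :: rem (nu x) (s x)).
  by apply: perm_to_rem; case: (nuP x).
have [||t tP tcvg] := IHs (fun x => rem (nu x) (s x)).
- by move=> x; rewrite size_rem ?ss //; case: (nuP x).
- apply: (@coef_cvg_divXsubC (size s0).+1 _ _ nu m) => //.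
  + move=> x; rewrite size_prod_XsubC size_rem ?ss //; by case: (nuP x).
  + by rewrite size_prod_XsubC.
  + move=> k; have := sp k; rewrite big_cons.
    by under eq_fun => x do rewrite (perm_big _ (sE x)) big_cons.
exists (fun x => nu x :: t x).
  by move=> x; rewrite (perm_trans _ (_ : perm_eq (nu x :: rem (nu x) (s x)) _))
    ?perm_cons // perm_sym.
by case=> [|i] /= ilt; [exact: num|exact: tcvg].
Qed.

Lemma count_roots_near (s0 : seq C) (s : T -> seq C) (l r : C) : 0 < r ->
  (forall x, size (s x) = size s0) ->
  coef_cvg (fun x => \prod_(z <- s x) ('X - z%:P)) (\prod_(z <- s0) ('X - z%:P)) ->
  (forall z, z \in s0 -> closure (ball l r) z -> z = l) ->
  \forall x \near F, count (fun z => `[< ball l r z >]) (s x) = count_mem l s0.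
Proof.
move=> r0 ss sp iso; have [t ts tcvg] := roots_cvg ss sp.
have st x : size (t x) = size s0 by rewrite (perm_size (ts x)) ss.
have : \forall x \near F, forall i : 'I_(size s0),
    `[< ball l r (nth 0 (t x) i) >] = (nth 0 s0 i == l).
  apply: filter_forall => i; have tc := tcvg i (ltn_ord i).
  have [il|il] := eqVneq (nth 0 s0 i) l.
    have : \forall x \near F, ball l r (nth 0 (t x) i).
      by apply: tc; rewrite il; exact: nbhsx_ballx.
    by apply: filterS => x /asboolP.
  have : \forall x \near F, ~ closure (ball l r) (nth 0 (t x) i).
    apply: (tc (~` closure (ball l r))); apply: open_nbhs_nbhs; split.
      by apply: closed_openC; exact: closed_closure.
    by move=> /(iso _ (mem_nth _ (ltn_ord i))) /eqP; rewrite (negbTE il).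
  apply: filterS => x nb; apply/negbTE/asboolPn => bx.
  by apply: nb; exact: subset_closure.
apply: filterS => x bE; rewrite -(permP (ts x)).
transitivity (count id [seq `[< ball l r z >] | z <- t x]).
  by rewrite count_map.
transitivity (count id [seq z == l | z <- s0]); last by rewrite count_map.
congr (count _ _); apply: (@eq_from_nth _ false); rewrite ?size_map ?st // => i il.
by rewrite !(nth_map 0) ?st // (bE (Ordinal il)).
Qed.

End RootContinuity.

(** Half the distance from l to the other points of s works. *)
Lemma isolating_radius (C : numClosedFieldType) (s : seq C) (l : C) :
  exists2 e : C, 0 < e & forall z, z \in s -> closure (ball l e) z -> z = l.
Proof.
have [e e0 eP] : exists2 e : C, 0 < e & forall z, z \in s -> z != l -> e <= `|l - z|.
  elim: s => [|y s [e e0 eP]]; first by exists 1.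
  have [->|yl] := eqVneq y l.
    exists e => // z; rewrite inE => /orP[/eqP->|]; first by rewrite eqxx.
    exact: eP.
  have ly0 : 0 < `|l - y| by rewrite normr_gt0 subr_eq0 eq_sym.
  have /orP[le|le] : (e <= `|l - y|) || (`|l - y| <= e).
    by apply: real_leVge; rewrite realE ?(ltW e0) ?(ltW ly0).
  - exists e => // z; rewrite inE => /orP[/eqP-> //|]; exact: eP.
  - exists `|l - y| => // z; rewrite inE => /orP[/eqP-> //|zs zl].
    by apply: le_trans le _; exact: eP.
have e20 : 0 < e / 2 by rewrite divr_gt0.
exists (e / 2) => // z zs cz; apply/eqP; apply: contraT => zl.
have [y [ly zy]] := cz _ (nbhsx_ballx z (e / 2) e20).
have := eP z zs zl; rewrite real_leNgt ?gtr0_real ?normr_gt0 ?subr_eq0 1?eq_sym //.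
move=> /negP; case.
rewrite -ball_normE in ly; rewrite (le_lt_trans (ler_distD y _ _)) //.
rewrite [ltRHS]splitr ltrD //.
by rewrite distrC; move: zy; rewrite -ball_normE.
Qed.

Section SimpleSpectrum.
Variable C : numClosedFieldType.

(** The eigenvalues of M are pairwise distinct and nonzero. *)
Definition simple_spectrum n (M : 'M[C]_n) :=
  separable_poly (char_poly M) && ~~ root (char_poly M) 0.

Lemma simple_spectrumP n (M : 'M[C]_n) s :
  char_poly M = \prod_(z <- s) ('X - z%:P) ->
  simple_spectrum M = uniq s && (0 \notin s).
Proof.
by move=> Ms; rewrite /simple_spectrum Ms separable_prod_XsubC root_prod_XsubC.
Qed.

Lemma char_poly_roots n (M : 'M[C]_n) :
  {s | char_poly M = \prod_(z <- s) ('X - z%:P) & size s = n}.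
Proof.
have [s sE] := closed_field_poly_normal (char_poly M).
move: sE; rewrite (monicP (char_poly_monic M)) scale1r => sE; exists s => //.
by apply: succn_inj; rewrite -(size_char_poly M) sE size_prod_XsubC.
Qed.

(** On the line through M and N, simplicity of the spectrum is the nonvanishing
    of a polynomial in the parameter s: the discriminant of the characteristic
    polynomial times its constant coefficient. This polynomial is nonzero
    at s = 1, so it has finitely many roots. *)
Lemma simple_spectrum_perturb n (M N : 'M[C]_n) (e : C) :
  0 < e -> simple_spectrum N ->
  exists2 s : C, `|s| < e & simple_spectrum (M + s *: (N - M)).
Proof.
case: n M N => [|n] M N e0 simN.
  by exists 0; rewrite ?normr0 // (_ : _ + _ = N) // !thinmx0.
pose K : 'M[{poly C}]_n.+1 := map_mx polyC M + 'X *: map_mx polyC (N - M).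
pose Q := char_poly K; pose D := resultant Q Q^`() * Q`_0.
have mapK s : map_mx (horner_eval s) K = M + s *: (N - M).
  by apply/matrixP => i j; rewrite !mxE /= /horner_eval !hornerE mulrC.
have mapQ s : map_poly (horner_eval s) Q = char_poly (M + s *: (N - M)).
  by rewrite map_char_poly mapK.
have leadQ' : lead_coef Q^`() = n.+1%:R.
  have lt : (size Q^`() <= n.+1)%N.
    by rewrite -ltnS -(size_char_poly K); apply: lt_size_deriv;
      rewrite -size_poly_gt0 size_char_poly.
  have cn : Q^`()`_n = n.+1%:R.
    rewrite coef_deriv (_ : Q`_n.+1 = 1) //.
    by have /monicP := char_poly_monic K; rewrite lead_coefE size_char_poly.
  rewrite lead_coefE (_ : (size Q^`()).-1 = n) //; apply: succn_inj.
  have gt : (n < size Q^`())%N.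
    rewrite ltnNge; apply/negP => le; move: cn; rewrite nth_default // => /esym/eqP.
    by rewrite -polyC_natr polyC_eq0 pnatr_eq0.
  by rewrite prednK ?(leq_ltn_trans _ gt) //; apply/eqP; rewrite eqn_leq lt gt.
have evalD s : (D.[s] != 0) = simple_spectrum (M + s *: (N - M)).
  rewrite /D hornerM mulf_eq0 negb_or.
  have -> : (resultant Q Q^`()).[s] =
      resultant (char_poly (M + s *: (N - M))) (char_poly (M + s *: (N - M)))^`().
    rewrite -mapQ deriv_map -map_resultant //.
    - by rewrite (monicP (char_poly_monic K)) rmorph1 oner_eq0.
    - by rewrite leadQ' rmorph_nat pnatr_eq0.
  have -> : (Q`_0).[s] = (char_poly (M + s *: (N - M)))`_0.
    by rewrite -mapQ coef_map.
  rewrite /simple_spectrum rootE -horner_coef0; congr (_ && _).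
  rewrite resultant_eq0 -leqNgt unlock /separable_poly /coprimep.
  rewrite eqn_leq (_ : (0 < _)%N) ?andbT // size_poly_gt0 gcdp_eq0.
  by rewrite (negbTE (monic_neq0 (char_poly_monic _))).
have D0 : D != 0.
  have := evalD 1; rewrite scale1r addrC subrK simN.
  by apply: contraNneq => ->; rewrite horner0.
(* As many points of small modulus as the size of D: one is not a root of D. *)
pose rs := [seq e / k.+2%:R | k <- iota 0 (size D)].
have uniq_rs : uniq rs.
  rewrite map_inj_uniq ?iota_uniq // => i j /(mulfI (lt0r_neq0 e0))/invr_inj/eqP.
  by rewrite eqr_nat => /eqP[].
have := contraNN (fun h => max_poly_roots D0 h uniq_rs).
rewrite size_map size_iota ltnn => /(_ isT) /allPn[s /mapP[k _ ->]] nr.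
exists (e / k.+2%:R); last by rewrite -evalD.
rewrite normrM normfV normr_nat gtr0_norm // ltr_pdivrMr ?ltr0Sn //.
by rewrite ltr_pMr // ltr1n.
Qed.

End SimpleSpectrum.

(** * Minimal idempotents and rank one decompositions *)

Section DualFamily.
Variables (K : fieldType) (V : lmodType K) (n : nat) (f : 'I_n -> V -> K).
Hypothesis f_lin : forall q c x y, f q (c *: x + y) = c * f q x + f q y.
Hypothesis f_free : forall c : 'I_n -> K,
  (forall x, \sum_q c q * f q x = 0) -> forall q, c q = 0.

Let val x : 'rV[K]_n := \row_q f q x.

Let val_lin c x y : val (c *: x + y) = c *: val x + val y.
Proof. by apply/rowP => q; rewrite !mxE f_lin. Qed.

Let val0 : val 0 = 0.
Proof.
have := val_lin (-1) 0 0.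
by rewrite scaleN1r addNr scaleN1r addNr.
Qed.

Let val_sum m (c : 'I_m -> K) (x : 'I_m -> V) :
  val (\sum_i c i *: x i) = \sum_i c i *: val (x i).
Proof.
apply: (big_ind2 (fun y v => val y = v)) => [|y v z w yv zw|i _].
- exact: val0.
- by rewrite -[y]scale1r val_lin scale1r yv zw.
- by rewrite -[_ *: x i]addr0 val_lin val0 addr0.
Qed.

(** A dual family is a preimage of the standard basis under x |-> (f_q x)_q.
    The image of this map is a space of row vectors; it is everything, as
    otherwise a nonzero column c would annihilate it, contradicting f_free. *)
Lemma dual_family : exists g : 'I_n -> V, forall j q, f q (g j) = (j == q)%:R.
Proof.
pose inW (X : 'M[K]_n) := exists x : 'I_n -> V, forall i, row i X = val (x i).
have ex0 : exists k, `[< exists2 X, inW X & \rank X = k >].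
  exists 0%N; apply/asboolP; exists 0; last by rewrite mxrank0.
  by exists (fun=> 0) => i; rewrite row0 val0.
have ub k : `[< exists2 X, inW X & \rank X = k >] -> (k <= n)%N.
  by move=> /asboolP[X _ <-]; exact: rank_leq_row.
case: (ex_maxnP ex0 ub) => k /asboolP[X [x xX] rX] kmax.
have submx y : (val y <= X)%MS.
  apply: contraT => nle.
  have ltX : (X < X + val y)%MS by rewrite ltmxE addsmxSl addsmx_sub submx_refl.
  have := rank_ltmx ltX; rewrite rX ltnNge (kmax (\rank (X + val y)%MS)) //.
  apply/asboolP; exists (X + val y)%MS => //.
  suff row_in i : exists z, row i (X + val y)%MS = val z.
    by have [z zP] := choice row_in; exists z.
  have /sub_addsmxP[[u v] /= ->] := row_sub i (X + val y)%MS.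
  exists (v 0 0 *: y + \sum_k u 0 k *: x k).
  rewrite val_lin val_sum [RHS]addrC mulmx_sum_row; congr (_ + _).
    by apply: eq_bigr => j _; rewrite xX.
  by rewrite [v]mx11_scalar mul_scalar_mx mxE eqxx mulr1n.
have full : row_full X.
  apply: contraT => nfull.
  have ncok : cokermx X != 0.
    rewrite -mxrank_eq0 mxrank_coker subn_eq0 -ltnNge ltn_neqAle rank_leq_col.
    by rewrite andbT.
  have valY y : val y *m cokermx X = 0 by apply/eqP; rewrite -submxE.
  move: (cokermx X) ncok valY => Y /eqP Y0 valY; case: Y0; apply/matrixP => q j.
  rewrite [RHS]mxE; move: q; apply: (f_free (c := Y^~ j)) => y.
  have := valY y; move=> /rowP/(_ j); rewrite !mxE => valYj.
  by rewrite -[RHS]valYj; apply: eq_bigr => q _; rewrite mxE mulrC.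
have /submxP[B B1] : (1%:M <= X)%MS by rewrite sub1mx.
exists (fun j => \sum_k B j k *: x k) => j q.
have : val (\sum_k B j k *: x k) = row j 1%:M.
  rewrite val_sum B1 row_mul mulmx_sum_row.
  by apply: eq_bigr => k' _; rewrite xX mxE.
by move=> /rowP/(_ q); rewrite !mxE.
Qed.

End DualFamily.

Section Semiprime.
Variables (C : numClosedFieldType) (A : banachAlgType C).

Definition semiprime := forall w : A, (forall x, w * x * w = 0) -> w = 0.

(** If w were outside a maximal left ideal I, then I + A w would be a strictly
    larger left ideal. It is proper: if 1 - x w were in I, then so would be x w
    = x w (1 - x w), and hence 1. *)
Lemma semisimple_semiprime : semisimple A -> semiprime.
Proof.
move=> ss w wAw; suff : jacobson_radical (A := A) w by rewrite ss.
move=> I [[I0 I1 Iid] Imax]; apply: contraT => wI.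
pose J : {pred A} := fun y => `[< exists x, y - x * w \in I >].
have J_id : idealr_closed J.
  split.
  - by apply/asboolP; exists 0; rewrite mul0r subr0.
  - apply/asboolP => -[x xI].
    have xwI : x * w \in I.
      have := Iid (x * w) _ 0 xI I0; rewrite addr0 mulrBr mulr1.
      by rewrite -!mulrA (mulrA w) wAw mulr0 subr0.
    by move/negP: I1; apply; have := Iid 1 _ _ xI xwI; rewrite mul1r subrK.
  - move=> c u v /asboolP[x xI] /asboolP[y yI]; apply/asboolP.
    exists (c * x + y); have := Iid c _ _ xI yI.
    by rewrite mulrBr mulrDl mulrA addrACA -opprD.
have IJ : {subset I <= J}.
  by move=> y yI; apply/asboolP; exists 0; rewrite mul0r subr0.
have : w \in J by apply/asboolP; exists 1; rewrite mul1r subrr.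
by move=> /(Imax J J_id IJ); rewrite (negbTE wI).
Qed.

End Semiprime.

Section Frame.
Variables (C : numClosedFieldType) (A : banachAlgType C).
Hypothesis sp : semiprime A.

Let sp_neq0 (w : A) : w != 0 -> exists x, w * x * w != 0.
Proof.
move=> /eqP w0; apply: contrapT => nex; apply: w0; apply: sp => x.
by apply/eqP; apply: contraT => xn; case: nex; exists x.
Qed.

(** Orthogonality is asked of the whole corner r A r': in a semiprime algebra,
    the members of E then generate distinct simple components of the socle. *)
Definition orthogonal_idempotents (E : seq A) :=
  (forall r, r \in E -> rank_one r /\ r * r = r) /\
  (forall r r', r \in E -> r' \in E -> r != r' -> forall x, r * x * r' = 0).

Definition factors_through (E : seq A) (u : A) :=
  exists r y z, r \in E /\ u = y * r * z.

(** Since u A u is a nonzero line, some x is normalized by u x u = u, and then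
    x u is a minimal idempotent. *)
Lemma rank_one_idempotent (u : A) : rank_one u ->
  exists x, [/\ u = u * (x * u), rank_one (x * u) & x * u * (x * u) = x * u].
Proof.
move=> [u0 uAu]; have [x xn] := sp_neq0 u0; have [c cE] := uAu x.
have c0 : c != 0 by apply: contraNneq xn => c0; rewrite cE c0 scale0r.
have uE : u = u * (c^-1 *: x * u).
  by rewrite -scalerAl -scalerAr mulrA cE scalerA mulVf // scale1r.
exists (c^-1 *: x); move: (c^-1 *: x) uE => y uE; split=> //; last first.
  by rewrite -mulrA -uE.
split; first by apply: contraNneq u0 => e0; rewrite uE e0 mulr0.
move=> z; have [d dE] := uAu (z * y); exists d.
by rewrite scalerAr -dE !mulrA.
Qed.

(** Rank one elements are added one at a time. The minimal idempotent e through
    which u factors is either equivalent to a member of E, through which u then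
    factors too, or orthogonal to all of E in the strong sense; then it joins E. *)
Lemma orthogonal_idempotents_cover (s : seq A) :
  (forall u, u \in s -> rank_one u) ->
  exists E, [/\ uniq E, orthogonal_idempotents E &
    forall u, u \in s -> factors_through E u].
Proof.
elim: s => [|u s IHs] s1; first by exists [::]; split.
have [u' u's|E [uE [E1 E2] sE]] := IHs; first by apply: s1; rewrite inE u's orbT.
have [x [ue e1 ee]] := rank_one_idempotent (s1 u (mem_head _ _)).
move: (x * u) ue e1 ee => e ue [e0 eAe] ee.
have [[r rE [y erE]]|none] :=
  pselect (exists2 r, r \in E & exists y, e * y * r != 0).
  exists E; split=> // u'; rewrite inE => /orP[/eqP->{u'}|]; last exact: sE.
  have [z zn] := sp_neq0 erE.
  have [c cE] := eAe (y * r * z).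
  have c0 : c != 0.
    apply: contraNneq zn => c0; rewrite !mulrA; move: cE; rewrite !mulrA => ->.
    by rewrite c0 scale0r !mul0r.
  exists r, (u * e * y), (c^-1 *: (z * e)); split=> //.
  rewrite -scalerAr; have : e * y * r * z * e = c *: e by rewrite -cE !mulrA.
  rewrite -!mulrA => ->; rewrite -scalerAr scalerA mulVf // scale1r.
  exact: ue.
have eE0 r y : r \in E -> e * y * r = 0.
  move=> rE; apply/eqP; apply: contraT => n0; case: none.
  by exists r => //; exists y.
have Ee0 r y : r \in E -> r * y * e = 0.
  move=> rE; apply/eqP; apply: contraT => /sp_neq0[z].
  by rewrite -!mulrA (mulrA e) (mulrA (e * z)) eE0 // !mul0r !mulr0 eqxx.
have eE : e \notin E.
  by apply: contra e0 => eE; rewrite -ee -[X in X * _]ee (eE0 _ e).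
exists (e :: E); split; first by rewrite /= eE.
- split=> [r|r r']; rewrite !inE.
    by case/orP => [/eqP->|/E1//]; split.
  move=> /orP[/eqP->|rE] /orP[/eqP->|r'E] rr' y; rewrite ?eqxx // in rr' *.
  + exact: eE0.
  + exact: Ee0.
  + exact: E2.
- move=> u'; rewrite inE => /orP[/eqP->|/sE[r [y [z [rE ->]]]]].
    by exists e, u, 1; split; rewrite ?mem_head // mulr1.
  by exists r, y, z; rewrite inE rE orbT.
Qed.

Definition corner_coord (r x : A) : C := xget 0 [set c | r * x * r = c *: r].

Lemma corner_coordP r x : rank_one r -> r * x * r = corner_coord r x *: r.
Proof.
move=> [_ /(_ x)[c rc]].
exact: (@xgetI _ 0 [set c | r * x * r = c *: r] c rc).
Qed.

Lemma corner_coord_eq r x c :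
  rank_one r -> r * x * r = c *: r -> corner_coord r x = c.
Proof.
move=> r1 xc; apply/eqP; rewrite -subr_eq0.
have : (corner_coord r x - c) *: r = 0 by rewrite scalerBl -corner_coordP // xc subrr.
by move=> /eqP; rewrite scaler_eq0 (negbTE r1.1) orbF.
Qed.

Lemma corner_coord_lin r c x y : rank_one r ->
  corner_coord r (c *: x + y) = c * corner_coord r x + corner_coord r y.
Proof.
move=> r1; apply: corner_coord_eq => //.
by rewrite mulrDr mulrDl -scalerAr -scalerAl !corner_coordP // scalerA scalerDl.
Qed.

Lemma corner_coord_bound r x : rank_one r -> `|corner_coord r x| <= `|r| * `|x|.
Proof.
move=> r1; have r0 : 0 < `|r| by rewrite normr_gt0; case: r1.
rewrite -(ler_pM2r r0) -normrZ -corner_coordP //.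
apply: le_trans (banach_normM _ _) _; rewrite ler_pM2r //.
exact: banach_normM.
Qed.

(** One functional phi for all corners: r A r' is the line spanned by r when r
    = r' and is 0 otherwise, and both cases are expressed by saying that its
    elements are multiples of r and of r' with coefficient given by phi. *)
Record frame (E : seq A) (phi : A -> C) : Prop := Frame {
  frame_lin : forall c x y, phi (c *: x + y) = c * phi x + phi y;
  frame_idem : forall r, r \in E -> r * r = r;
  frame_cornerl : forall r r' x, r \in E -> r' \in E ->
    r * x * r' = phi (r * x * r') *: r;
  frame_cornerr : forall r r' x, r \in E -> r' \in E ->
    r * x * r' = phi (r * x * r') *: r';
  frame_comm : forall r x, r \in E -> phi (r * x) = phi (x * r);
  frame_bound : exists2 K, 0 <= K & forall x, `|phi x| <= K * `|x| }.

(** Orthogonality ensures that only the term r of the sum survives on elements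
    of r A or of A r. *)
Lemma frame_exists E : uniq E -> orthogonal_idempotents E ->
  frame E (fun x => \sum_(r <- E) corner_coord r x).
Proof.
move=> uE [E1 E2].
have coord0 r : r \in E -> corner_coord r 0 = 0.
  by move=> /E1[r1 _]; apply: corner_coord_eq => //; rewrite mulr0 mul0r scale0r.
have phi0 : \sum_(r <- E) corner_coord r 0 = 0.
  by rewrite big_seq big1 // => r; exact: coord0.
have phil r x : r \in E ->
    \sum_(r' <- E) corner_coord r' (r * x) = corner_coord r x.
  move=> rE; rewrite (bigD1_seq r) //= big_seq_cond big1 ?addr0 //.
    have [r1 rr] := E1 r rE; apply: corner_coord_eq => //.
    by rewrite mulrA rr corner_coordP.
  move=> r' /andP[r'E r'r]; apply: corner_coord_eq; first by case: (E1 r').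
  have r'r0 : r' * r = 0 by rewrite -[r']mulr1 E2.
  by rewrite scale0r mulrA r'r0 !mul0r.
have phir r x : r \in E ->
    \sum_(r' <- E) corner_coord r' (x * r) = corner_coord r x.
  move=> rE; rewrite (bigD1_seq r) //= big_seq_cond big1 ?addr0 //.
    have [r1 rr] := E1 r rE; apply: corner_coord_eq => //.
    by rewrite -!mulrA rr mulrA corner_coordP.
  move=> r' /andP[r'E r'r]; apply: corner_coord_eq; first by case: (E1 r').
  have rr'0 : r * r' = 0 by rewrite -[r]mulr1 E2 // eq_sym.
  by rewrite scale0r -!mulrA rr'0 !mulr0.
have corner r r' x : r \in E -> r' \in E ->
    r * x * r' = (\sum_(s <- E) corner_coord s (r * x * r')) *: r /\
    (r = r' \/ r * x * r' = 0).
  move=> rE r'E; have [<-|nrr] := eqVneq r r'.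
    split; last by left.
    rewrite phir // corner_coordP; last by case: (E1 r).
    congr (_ *: _); apply/esym/corner_coord_eq; first by case: (E1 r).
    by rewrite mulrA (E1 r rE).2 corner_coordP //; case: (E1 r).
  by rewrite E2 // phi0 scale0r; split=> //; right.
split.
- move=> c x y; rewrite mulr_sumr -big_split /= big_seq [RHS]big_seq.
  by apply: eq_bigr => r /E1[r1 _]; exact: corner_coord_lin.
- by move=> r /E1[].
- by move=> r r' x rE r'E; case: (corner r r' x rE r'E).
- move=> r r' x rE r'E; have [h [rr'|e0]] := corner r r' x rE r'E.
    by move: h; rewrite -rr'.
  by rewrite e0 phi0 scale0r.
- by move=> r x rE; rewrite phil // phir.
- exists (\sum_(r <- E) `|r|) => [|x]; first by rewrite sumr_ge0.
  apply: le_trans (ler_norm_sum _ _ _) _.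
  rewrite mulr_suml big_seq [leRHS]big_seq; apply: ler_sum => r /E1[r1 _].
  exact: corner_coord_bound.
Qed.

(** Writes a as a finite rank operator: the al i are vectors, the be i
    covectors, and r i records which simple component they belong to. *)
Definition decomposition (E : seq A) (a : A) n (al be r : 'I_n -> A) :=
  [/\ forall i, r i \in E, forall i, al i * r i = al i,
      forall i, r i * be i = be i & a = \sum_i al i * be i].

Lemma decomposition_exists E (s : seq A) :
  orthogonal_idempotents E ->
  (forall u, u \in s -> factors_through E u) ->
  exists n (al be r : 'I_n -> A), decomposition E (\sum_(u <- s) u) al be r.
Proof.
move=> [E1 _] sE.
have fac (i : 'I_(size s)) : exists t : A * A * A,
    t.1.1 \in E /\ s`_i = t.1.2 * t.1.1 * t.2.
  by have [r [y [z h]]] := sE _ (mem_nth 0 (ltn_ord i)); exists (r, y, z).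
have [t tP] := choice fac.
exists (size s), (fun i => (t i).1.2 * (t i).1.1),
  (fun i => (t i).1.1 * (t i).2), (fun i => (t i).1.1).
have idem i : (t i).1.1 * (t i).1.1 = (t i).1.1 by case: (E1 _ (tP i).1).
split=> [i|i|i|]; first by case: (tP i).
- by rewrite -mulrA idem.
- by rewrite mulrA idem.
- rewrite (big_nth 0) big_mkord; apply: eq_bigr => i _.
  by rewrite (tP i).2 mulrA -[X in _ = X * _]mulrA idem.
Qed.

End Frame.

(** * The Gram matrix of a decomposition *)

Section Gram.
Variables (C : numClosedFieldType) (A : banachAlgType C).
Hypothesis sp : semiprime A.
Variables (E : seq A) (phi : A -> C).
Hypothesis fr : frame E phi.

Let phi_lin := frame_lin fr.

Lemma frame0 : phi 0 = 0.
Proof.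
have := phi_lin (-1) 0 0.
by rewrite scaleN1r addNr mulN1r addNr.
Qed.

Lemma frameD x y : phi (x + y) = phi x + phi y.
Proof. by rewrite -[x]scale1r phi_lin mul1r scale1r. Qed.

Lemma frameZ c x : phi (c *: x) = c * phi x.
Proof. by rewrite -[_ *: _]addr0 phi_lin frame0 addr0. Qed.

Lemma frameB x y : phi (x - y) = phi x - phi y.
Proof. by rewrite frameD -scaleN1r frameZ mulN1r. Qed.

Lemma frame_sum (I : Type) (s : seq I) (x : I -> A) :
  phi (\sum_(i <- s) x i) = \sum_(i <- s) phi (x i).
Proof.
apply: (big_ind2 (fun u v => phi u = v)) => //; first exact: frame0.
by move=> u _ v _ <- <-; rewrite frameD.
Qed.

(** The functional is multiplicative along composable corners, as the matrix
    coefficients of one-dimensional maps. *)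
Lemma frame_mul r s u v : r \in E -> s \in E ->
  r * u = u -> u * s = u -> s * v = v -> phi (u * v) = phi u * phi v.
Proof.
move=> rE sE ru us sv.
have uE : u = phi u *: s by have := frame_cornerr fr u rE sE; rewrite ru us.
by rewrite [in LHS]uE -scalerAl frameZ sv.
Qed.

Section Decomposition.
Variables (a : A) (n : nat) (al be r : 'I_n -> A).
Hypothesis D : decomposition E a al be r.

Let rE i : r i \in E. Proof. by case: D. Qed.
Let alr i : al i * r i = al i. Proof. by case: D. Qed.
Let rbe i : r i * be i = be i. Proof. by case: D. Qed.
Let aE : a = \sum_i al i * be i. Proof. by case: D. Qed.

(** If a is seen as a product U V of a row U of vectors and a column V of
    covectors, then x a is (x U) V and gram x is V (x U). *)
Definition gram (x : A) : 'M[C]_n := \matrix_(i, j) phi (be i * x * al j).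

Lemma gram_lin c x y : gram (c *: x + y) = c *: gram x + gram y.
Proof.
apply/matrixP => i j; rewrite !mxE mulrDr mulrDl frameD.
by rewrite -scalerAr -scalerAl frameZ.
Qed.

Lemma al_gram x i j : al i * (be i * x * al j) = gram x i j *: al i.
Proof.
have -> : be i * x * al j = r i * (be i * x * al j) * r j.
  by rewrite -!mulrA alr !mulrA rbe.
rewrite (frame_cornerl fr _ (rE i) (rE j)) -scalerAr alr mxE.
by rewrite -!mulrA alr !mulrA rbe.
Qed.

Lemma gram_be x i j : be i * x * al j * be j = gram x i j *: be j.
Proof.
have -> : be i * x * al j = r i * (be i * x * al j) * r j.
  by rewrite -!mulrA alr !mulrA rbe.
rewrite (frame_cornerr fr _ (rE i) (rE j)) -scalerAl rbe mxE.
by rewrite -!mulrA alr !mulrA rbe.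
Qed.

Lemma be_mul x i : be i * (x * a) = \sum_k gram x i k *: be k.
Proof.
rewrite aE mulrA mulr_sumr; apply: eq_bigr => k _.
by rewrite mulrA gram_be.
Qed.

(** V x (U V) y U is the product of V x U and V y U. *)
Lemma gramM x y : gram (x * a * y) = gram x *m gram y.
Proof.
apply/matrixP => i j; rewrite mxE (mulrA _ _ y) be_mul !mulr_suml frame_sum mxE.
by apply: eq_bigr => k _; rewrite -!scalerAl frameZ [gram y k j]mxE.
Qed.

(** With U and V as for gram, this is the element U N V. *)
Definition sandwich (N : 'M[C]_n) : A := \sum_i \sum_j N i j *: (al i * be j).

Lemma sandwich1 : sandwich 1%:M = a.
Proof.
rewrite aE; apply: eq_bigr => i _; rewrite (bigD1 i) //= mxE eqxx scale1r.
rewrite big1 ?addr0 // => j ji; rewrite mxE eq_sym (negbTE ji).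
by rewrite scale0r.
Qed.

Lemma sandwichD N N' : sandwich (N + N') = sandwich N + sandwich N'.
Proof.
rewrite -big_split; apply: eq_bigr => i _; rewrite -big_split.
by apply: eq_bigr => j _; rewrite mxE scalerDl.
Qed.

Lemma sandwichZ c N : sandwich (c *: N) = c *: sandwich N.
Proof.
rewrite scaler_sumr; apply: eq_bigr => i _; rewrite scaler_sumr.
by apply: eq_bigr => j _; rewrite mxE scalerA.
Qed.

Lemma sandwich_mulr N x : sandwich N * (x * a) = sandwich (N *m gram x).
Proof.
rewrite mulr_suml; apply: eq_bigr => i _; rewrite mulr_suml.
under eq_bigr do rewrite -scalerAl -mulrA be_mul mulr_sumr scaler_sumr.
rewrite exchange_big; apply: eq_bigr => k _; rewrite mxE scaler_suml.
by apply: eq_bigr => j _; rewrite -scalerAr scalerA.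
Qed.

Lemma sandwich_mull N x : a * (x * sandwich N) = sandwich (gram x *m N).
Proof.
rewrite {1}aE mulr_suml; apply: eq_bigr => k _.
rewrite /sandwich !mulr_sumr.
under eq_bigr do rewrite !mulr_sumr.
rewrite exchange_big; apply: eq_bigr => j _; rewrite mxE scaler_suml.
apply: eq_bigr => i _; rewrite -!scalerAr mulrC -scalerA; congr (_ *: _).
transitivity (al k * (be k * x * al i) * be j); first by rewrite !mulrA.
by rewrite al_gram scalerAl.
Qed.

(** From an inverse N of gram x - z one gets the inverse of z - x a, namely
    z^-1 (1 - x U N V). *)
Lemma spectrum_gram x z : z != 0 ->
  spectrum (x * a) z -> root (char_poly (gram x)) z.
Proof.
move=> z0; rewrite /spectrum /=; apply: contraNT.
rewrite -eigenvalue_root_char /eigenvalue negbK kermx_eq0 row_free_unit => uH.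
set H := gram x - z%:M in uH; pose N := invmx H.
have HN : gram x *m N = z *: N + 1%:M.
  by rewrite -(mulmxV uH) mulmxBl mul_scalar_mx addrC subrK.
have NH : N *m gram x = z *: N + 1%:M.
  by rewrite -(mulVmx uH) mulmxBr mul_mx_scalar addrC subrK.
have yxa : x * sandwich N * (x * a) = z *: (x * sandwich N) + x * a.
  by rewrite -mulrA sandwich_mulr NH sandwichD sandwichZ sandwich1 mulrDr -scalerAr.
have xay : x * a * (x * sandwich N) = z *: (x * sandwich N) + x * a.
  by rewrite -mulrA sandwich_mull HN sandwichD sandwichZ sandwich1 mulrDr -scalerAr.
move: (x * sandwich N) yxa xay => y yxa xay.
have cancel : z *: y - (z *: y + x * a) = - (x * a).
  by rewrite opprD addrA subrr sub0r.
apply/unitrP; exists (z^-1 *: (1 - y)); split.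
- rewrite -scalerAl mulrBl mul1r mulrBr yxa -scalerAr mulr1 cancel.
  by rewrite opprK subrK scalerA mulVf // scale1r.
- rewrite -scalerAr mulrBr mulr1 mulrBl xay -scalerAl mul1r cancel.
  by rewrite opprK subrK scalerA mulVf // scale1r.
Qed.

Definition be_comb (v : 'rV[C]_n) : A := \sum_i v 0 i *: be i.

Lemma be_comb_mul v x : be_comb v * (x * a) = be_comb (v *m gram x).
Proof.
rewrite mulr_suml; under eq_bigr do rewrite -scalerAl be_mul scaler_sumr.
rewrite exchange_big; apply: eq_bigr => k _; rewrite mxE scaler_suml.
by apply: eq_bigr => i _; rewrite scalerA.
Qed.

(** A left eigenvector v of gram x gives w = sum v_i be_i with w x a = z w, and
    w is nonzero since phi(w x al_k) = z v_k. *)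
Lemma gram_root_spectrum x z : z != 0 ->
  root (char_poly (gram x)) z -> spectrum (x * a) z.
Proof.
move=> z0; rewrite -eigenvalue_root_char => /eigenvalueP[v vE v0].
apply/negP => /unitrP[y [_ zay]].
have w0 : be_comb v = 0.
  rewrite -[LHS]mulr1 -zay mulrA mulrBr be_comb_mul vE.
  rewrite -scalerAr mulr1 [X in _ - X](_ : _ = z *: be_comb v) ?subrr ?mul0r //.
  by rewrite scaler_sumr; apply: eq_bigr => i _; rewrite mxE scalerA.
case/eqP: v0; apply/rowP => k; apply: (mulfI z0); rewrite [in RHS]mxE mulr0.
have : phi (be_comb v * x * al k) = 0 by rewrite w0 !mul0r frame0.
rewrite !mulr_suml frame_sum => <-.
have := congr1 (fun u : 'rV_n => u 0 k) vE; rewrite !mxE => <-.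
by apply: eq_bigr => i _; rewrite mxE -!scalerAl frameZ.
Qed.

Lemma spectrum_gramP x z : z != 0 ->
  spectrum (x * a) z <-> root (char_poly (gram x)) z.
Proof. by move=> z0; split; [exact: spectrum_gram|exact: gram_root_spectrum]. Qed.

(** With N the inverse of gram x, the identity U N V x U V = U V gives a left
    inverse a^-1 U N V of x a; it is also a right inverse since a (x U N V) = a
    and a can be cancelled. *)
Lemma unit_gram_unit x : a \is a GRing.unit -> gram x \in unitmx ->
  x * a \is a GRing.unit.
Proof.
move=> ua ux; pose N := invmx (gram x).
have axN : a * (x * sandwich N) = a by rewrite sandwich_mull mulmxV // sandwich1.
have xN : x * sandwich N = 1 by apply: (mulrI ua); rewrite mulr1.
have Nx : sandwich N * (x * a) = a by rewrite sandwich_mulr mulVmx // sandwich1.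
apply/unitrP; exists (a^-1 * sandwich N); split.
  by rewrite -mulrA Nx mulVr.
by rewrite -mulrA (mulrA a) divrr // mul1r.
Qed.

(** This controls the point 0, which the Gram matrix does not see: it can be in
    an isolating disk only if a is invertible. *)
Lemma simple_spectrum0 x : simple_spectrum (gram x) ->
  spectrum (x * a) 0 -> spectrum a 0.
Proof.
move=> /andP[_ nr]; rewrite /spectrum /= !scale0r !sub0r !unitrN.
apply: contraNN => ua; apply: unit_gram_unit => //.
rewrite unitmxE unitfE; apply: contra nr => /eqP det0.
by rewrite rootE horner_coef0 char_poly_det det0 mulr0.
Qed.

End Decomposition.

(** A linear dependency inside one component lets the term q0 be absorbed by
    the others. *)
Lemma shrink_left n a (al be r : 'I_n.+1 -> A) q0 (d : 'I_n -> C) :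
  decomposition E a al be r ->
  al q0 = \sum_k d k *: (al (lift q0 k) * r q0) ->
  decomposition E a (fun k => al (lift q0 k))
    (fun k => be (lift q0 k) + d k *: (r (lift q0 k) * be q0))
    (fun k => r (lift q0 k)).
Proof.
move=> [rE alr rbe ->] alq0; split=> [k|k|k|]; rewrite ?alr //.
  by rewrite mulrDr rbe -scalerAr mulrA (frame_idem fr).
rewrite (bigD1_ord q0) //= alq0 mulr_suml -big_split; apply: eq_bigr => k _ /=.
by rewrite mulrDr addrC -scalerAl -scalerAr !mulrA alr -mulrA rbe.
Qed.

Lemma shrink_right n a (al be r : 'I_n.+1 -> A) q0 (d : 'I_n -> C) :
  decomposition E a al be r ->
  be q0 = \sum_k d k *: (r q0 * be (lift q0 k)) ->
  decomposition E a (fun k => al (lift q0 k) + d k *: (al q0 * r (lift q0 k)))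
    (fun k => be (lift q0 k)) (fun k => r (lift q0 k)).
Proof.
move=> [rE alr rbe ->] beq0; split=> [k|k|k|]; rewrite ?rbe //.
  by rewrite mulrDl alr -scalerAl -mulrA (frame_idem fr).
rewrite (bigD1_ord q0) //= beq0 mulr_sumr -big_split; apply: eq_bigr => k _ /=.
by rewrite mulrDl addrC -scalerAl -scalerAr !mulrA alr -mulrA rbe.
Qed.

(** This is where semiprimeness enters: (w s) x (w s) is w times an element of
    the corner s A s whose coordinate is phi(s x w) = 0. *)
Lemma frame_faithful_right w : (forall x, phi (x * w) = 0) ->
  forall s, s \in E -> w * s = 0.
Proof.
move=> phiw s sE; apply: sp => x.
have corner0 : s * (x * w) * s = 0.
  rewrite (frame_cornerr fr _ sE sE) (_ : phi _ = 0) ?scale0r //.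
  by rewrite -(frame_comm fr) // !mulrA (frame_idem fr) // phiw.
by rewrite -mulrA -mulrA mulrA -(mulrA w) !mulrA -!mulrA (mulrA s) (mulrA _ w s)
  -(mulrA s x w) corner0 mulr0.
Qed.

Lemma frame_faithful_left w : (forall x, phi (w * x) = 0) ->
  forall s, s \in E -> s * w = 0.
Proof.
move=> phiw s sE; apply: sp => x.
have corner0 : s * (w * x) * s = 0.
  rewrite (frame_cornerr fr _ sE sE) (_ : phi _ = 0) ?scale0r //.
  by rewrite -mulrA (frame_comm fr) // -!mulrA (frame_idem fr) // phiw.
by rewrite !mulrA -(mulrA s) corner0 mul0r.
Qed.

Section Minimal.
Variables (a : A) (n : nat) (al be r : 'I_n -> A).
Hypothesis D : decomposition E a al be r.
Hypothesis minD : forall m (al' be' r' : 'I_m -> A),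
  decomposition E a al' be' r' -> (n <= m)%N.

(** A relation among the al would give, after multiplication by r q0, a relation
    within one component, and shrink_left would shorten the decomposition. *)
Lemma minimal_left_free (c : 'I_n -> C) :
  (forall x, \sum_q c q * phi (x * al q) = 0) -> forall q, c q = 0.
Proof.
case: n al be r D minD c => [|m] al' be' r' D' min' c c0 q0; first by case: q0.
apply/eqP; apply: contraT => cq0; have [rE alr _ _] := D'.
have phiw x : phi (x * \sum_q c q *: al' q) = 0.
  rewrite mulr_sumr frame_sum -[RHS](c0 x); apply: eq_bigr => q _.
  by rewrite -scalerAr frameZ.
have := frame_faithful_right phiw (rE q0).
rewrite (bigD1_ord q0) //= mulrDl -scalerAl alr => /eqP.
rewrite addrC addr_eq0 => /eqP/esym ae.
suff /(shrink_left D')/min' : al' q0 =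
    \sum_k (- (c q0)^-1 * c (lift q0 k)) *: (al' (lift q0 k) * r' q0).
  by rewrite ltnn.
apply: (scalerI cq0); apply: oppr_inj; rewrite ae mulr_suml scaler_sumr -sumrN.
apply: eq_bigr => k _; rewrite scalerA mulrA mulrN mulfV // mulN1r scaleNr.
by rewrite opprK -scalerAl.
Qed.

Lemma minimal_right_free (c : 'I_n -> C) :
  (forall x, \sum_q c q * phi (be q * x) = 0) -> forall q, c q = 0.
Proof.
case: n al be r D minD c => [|m] al' be' r' D' min' c c0 q0; first by case: q0.
apply/eqP; apply: contraT => cq0; have [rE _ rbe _] := D'.
have phiw x : phi ((\sum_q c q *: be' q) * x) = 0.
  rewrite mulr_suml frame_sum -[RHS](c0 x); apply: eq_bigr => q _.
  by rewrite -scalerAl frameZ.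
have := frame_faithful_left phiw (rE q0).
rewrite (bigD1_ord q0) //= mulrDr -scalerAr rbe => /eqP.
rewrite addrC addr_eq0 => /eqP/esym ae.
suff /(shrink_right D')/min' : be' q0 =
    \sum_k (- (c q0)^-1 * c (lift q0 k)) *: (r' q0 * be' (lift q0 k)).
  by rewrite ltnn.
apply: (scalerI cq0); apply: oppr_inj; rewrite ae mulr_sumr scaler_sumr -sumrN.
apply: eq_bigr => k _; rewrite scalerA mulrA mulrN mulfV // mulN1r scaleNr.
by rewrite opprK -scalerAr.
Qed.

(** With families g and h dual to al and be, the element sum_k d_k h_k r_k g_k
    is sent to the diagonal matrix of d. *)
Lemma gram_diag (d : 'I_n -> C) : exists x, gram al be x = diag_mx (\row_i d i).
Proof.
have [g gP] : exists g : 'I_n -> A, forall j q, phi (g j * al q) = (j == q)%:R.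
  apply: (@dual_family _ _ _ (fun q x => phi (x * al q))) => [q c x y|].
    by rewrite mulrDl -scalerAl phi_lin.
  exact: minimal_left_free.
have [h hP] : exists h : 'I_n -> A, forall j q, phi (be q * h j) = (j == q)%:R.
  apply: (@dual_family _ _ _ (fun q x => phi (be q * x))) => [q c x y|].
    by rewrite mulrDr -scalerAr phi_lin.
  exact: minimal_right_free.
have [rE alr rbe _] := D.
have idem i : r i * r i = r i by rewrite (frame_idem fr).
have corner i k : r k * r i = phi (r k * r i) *: r i.
  by have := frame_cornerr fr 1 (rE k) (rE i); rewrite mulr1.
have phih i k : phi (be i * h k * r k) = (k == i)%:R.
  rewrite -(frame_comm fr) // mulrA -(rbe i); have [->|ki] := eqVneq k i.
    by rewrite mulrA idem rbe hP eqxx.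
  by rewrite mulrA corner -!scalerAl frameZ rbe hP (negbTE ki) mulr0.
have phig j k : phi (r k * g k * al j) = (k == j)%:R.
  rewrite -mulrA (frame_comm fr) //; have [->|kj] := eqVneq k j.
    by rewrite -mulrA alr gP eqxx.
  have [c rjk] : exists c, r j * r k = c *: r j.
    have := frame_cornerl fr 1 (rE j) (rE k); rewrite mulr1 => ->.
    by exists (phi (r j * r k)).
  have -> : g k * al j * r k = c *: (g k * al j).
    by rewrite -(alr j) -!mulrA rjk -!scalerAr alr.
  by rewrite frameZ gP (negbTE kj) mulr0.
exists (\sum_k d k *: (h k * r k * g k)); apply/matrixP => i j.
rewrite !mxE mulr_sumr mulr_suml frame_sum.
transitivity (\sum_k d k * ((k == i)%:R * (k == j)%:R)).
  apply: eq_bigr => k _; rewrite -scalerAr -scalerAl frameZ; congr (_ * _).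
  rewrite -phih -phig -(frame_mul (rE i) (rE k)); last 3 first.
  - by rewrite !mulrA rbe.
  - by rewrite -!mulrA idem.
  - by rewrite !mulrA idem.
  by congr (phi _); rewrite !mulrA -[X in _ = X * _ * _]mulrA idem.
rewrite (bigD1 i) //= eqxx mul1r big1 ?addr0 => [|k /negbTE->]; last first.
  by rewrite mul0r mulr0.
by case: (i == j); rewrite ?mulr1 ?mulr0 ?mulr1n ?mulr0n.
Qed.

Lemma gram_simple : exists x, simple_spectrum (gram al be x).
Proof.
have [x xE] := gram_diag (fun i => i.+1%:R); exists x.
rewrite (@simple_spectrumP _ _ _ [seq i.+1%:R | i : 'I_n]).
  rewrite map_inj_uniq ?enum_uniq => [|i j /eqP]; last first.
    by rewrite eqr_nat => /eqP[/val_inj].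
  by apply/mapP => -[i _ /esym/eqP]; rewrite pnatr_eq0.
rewrite xE char_poly_trig ?diag_mx_is_trig // big_map big_enum.
by apply: eq_bigr => i _; rewrite !mxE eqxx mulr1n.
Qed.

(** Unlike gram_root_spectrum, this covers z = 0: a null vector v gives w = sum
    v_i be_i with w a = 0, and w is nonzero by minimality. *)
Lemma gram1_root_spectrum z :
  root (char_poly (gram al be 1)) z -> spectrum a z.
Proof.
have [z0|zn] := eqVneq z 0; last first.
  by move=> /(gram_root_spectrum D zn); rewrite mul1r.
rewrite z0 -eigenvalue_root_char => /eigenvalueP[v vE v0].
rewrite /spectrum /= scale0r sub0r unitrN; apply/negP => ua.
have va : be_comb be v * a = 0.
  rewrite -[a]mul1r (be_comb_mul D) vE scale0r.
  by apply: big1 => i _; rewrite mxE scale0r.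
case/eqP: v0; apply/rowP => q; rewrite [RHS]mxE.
move: q; apply: (minimal_right_free (c := fun q => v 0 q)) => x.
have w0 : be_comb be v = 0 by apply: (mulIr ua); rewrite va mul0r.
transitivity (phi (be_comb be v * x)); last by rewrite w0 mul0r frame0.
by rewrite mulr_suml frame_sum; apply: eq_bigr => q _; rewrite -scalerAl frameZ.
Qed.

End Minimal.

Lemma gram_cvg n (al be : 'I_n -> A) (y : A) i j :
  gram al be x i j @[x --> y] --> gram al be y i j.
Proof.
have [K K0 KP] := frame_bound fr; pose L := K * `|be i| * `|al j| + 1.
have L0 : 0 < L by rewrite ltr_wpDl // !mulr_ge0.
apply/cvgrPdist_lt => e e0; near=> x.
have -> : gram al be y i j - gram al be x i j = phi (be i * (y - x) * al j).
  by rewrite !mxE mulrBr mulrBl frameB.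
apply: (@le_lt_trans _ _ (L * `|y - x|)).
  apply: le_trans (KP _) _; rewrite mulrDl mul1r ler_wpDr //.
  rewrite -!mulrA ler_wpM2l //; apply: le_trans (banach_normM _ _) _.
  by rewrite ler_wpM2l // [leRHS]mulrC; exact: banach_normM.
rewrite -ltr_pdivlMl //; near: x.
have : x @[x --> y] --> y by exact: cvg_id.
by move=> /cvgrPdist_lt; apply; rewrite mulr_gt0 // invr_gt0.
Unshelve. all: by end_near. Qed.

End Gram.

(** * The trace of a socle element *)

Section CommonTrace.
Variables (C : numClosedFieldType) (A : banachAlgType C).
Variables (E : seq A) (phi : A -> C).
Hypothesis fr : frame E phi.

(** With X = phi(be_i al'_j) and Y = phi(be'_i al_j), inserting p = sum al'_j
    be'_j between be and al shows that the first matrix is X Y; the second is Y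
    X. *)
Lemma trace_gram_unique (p : A) n (al be r : 'I_n -> A)
    n' (al' be' r' : 'I_n' -> A) :
  decomposition E p al be r -> decomposition E p al' be' r' ->
  \tr (gram phi al be p) = \tr (gram phi al' be' p).
Proof.
have cross m m' (x y : 'I_m -> A) (x' y' : 'I_m' -> A) s s' :
    decomposition E p x y s -> decomposition E p x' y' s' ->
    gram phi x y p = (\matrix_(i, j) phi (y i * x' j)) *m
                     (\matrix_(i, j) phi (y' i * x j)).
  move=> [sE _ sy _] [s'E x's' s'y' pE]; apply/matrixP => i k.
  rewrite !mxE {1}pE mulr_sumr mulr_suml (frame_sum fr).
  apply: eq_bigr => j _; rewrite !mxE -(frame_mul fr (sE i) (s'E j)) ?mulrA ?sy //.
    by rewrite -mulrA x's'.
  by rewrite s'y'.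
move=> D D'; rewrite (cross _ _ _ _ _ _ _ _ D D').
by rewrite (cross _ _ _ _ _ _ _ _ D' D) mxtrace_mulC.
Qed.

(** V (U V)^k U is the (k+1)-st power of V U, whence the extra factor X. *)
Lemma gram_horner_alg (a : A) n (al be r : 'I_n.+1 -> A) p :
  decomposition E a al be r ->
  gram phi al be (horner_alg a p) = horner_mx (gram phi al be 1) (p * 'X).
Proof.
move=> D; elim/poly_ind: p => [|p c IHp].
  rewrite mul0r !rmorph0; apply/matrixP => i j.
  by rewrite !mxE mulr0 mul0r (frame0 fr).
rewrite !rmorphD !rmorphM /= horner_algX horner_algC.
rewrite rmorphD rmorphM /= horner_mx_X horner_mx_C.
rewrite addrC (gram_lin fr) -[horner_alg a p * a]mulr1 (gramM fr D) IHp.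
by rewrite mulrDl rmorphM /= horner_mx_X -!mulmxE mul_scalar_mx addrC.
Qed.

Lemma sandwich_horner_mx (a : A) n (al be r : 'I_n.+1 -> A) p :
  decomposition E a al be r ->
  sandwich al be (horner_mx (gram phi al be 1) p) = horner_alg a (p * 'X).
Proof.
move=> D; elim/poly_ind: p => [|p c IHp].
  by rewrite mul0r !rmorph0 -(scale0r (0 : 'M[C]_n.+1)) sandwichZ scale0r.
have -> : horner_alg a ((p * 'X + c%:P) * 'X) =
    horner_alg a (p * 'X) * a + c *: a.
  by rewrite rmorphM rmorphD /= horner_algX horner_algC mulrDl -scalerAl mul1r.
rewrite rmorphD rmorphM /= horner_mx_X horner_mx_C sandwichD -mulmxE.
rewrite -(sandwich_mulr fr D) mul1r IHp.
by rewrite -scalemx1 sandwichZ (sandwich1 D).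
Qed.

(** Cayley-Hamilton for V U gives U chi(V U) V = 0, which is chi(a) a. *)
Lemma char_poly_annihilates (a : A) n (al be r : 'I_n -> A) :
  decomposition E a al be r ->
  horner_alg a (char_poly (gram phi al be 1) * 'X) = 0.
Proof.
case: n al be r => [|n] al be r D.
  have -> : a = 0 by case: D => _ _ _ ->; rewrite big_ord0.
  by rewrite rmorphM /= horner_algX mulr0.
rewrite -(sandwich_horner_mx _ D) Cayley_Hamilton.
by rewrite -(scale0r (0 : 'M[C]_n.+1)) sandwichZ scale0r.
Qed.

Lemma decomposition_mull (a u : A) n (al be r : 'I_n -> A) :
  decomposition E a al be r ->
  decomposition E (u * a) (fun j => u * al j) be r.
Proof.
move=> [rE alr rbe ->]; split=> // [i|]; first by rewrite -mulrA alr.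
by rewrite mulr_sumr; apply: eq_bigr => i _; rewrite mulrA.
Qed.

(** With f = g X and M = gram 1, the matrix is f(M)^2, which is f(M) by
    Cayley-Hamilton, and its trace is the sum of f(z) over the eigenvalues z. *)
Lemma trace_spectral_idempotent (a : A) n (al be r : 'I_n -> A) (s : seq C)
    (l : C) (g : {poly C}) :
  decomposition E a al be r ->
  char_poly (gram phi al be 1) = \prod_(z <- s) ('X - z%:P) ->
  char_poly (gram phi al be 1) %| (g * 'X) * (1 - g * 'X) ->
  (forall z, z \in s -> (g * 'X).[z] = (z == l)%:R) ->
  \tr (gram phi (fun j => horner_alg a g * al j) be (horner_alg a (g * 'X))) =
  (count_mem l s)%:R.
Proof.
case: n al be r => [|n] al be r D sE dvd ev.
  have -> : s = [::].
    apply/size0nil/succn_inj; rewrite -(size_prod_XsubC s id) -sE.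
    by rewrite size_char_poly.
  by rewrite /mxtrace big_ord0.
have -> : gram phi (fun j => horner_alg a g * al j) be (horner_alg a (g * 'X)) =
    gram phi al be (horner_alg a (g * 'X * g)).
  by apply/matrixP => i j; rewrite !mxE [in RHS]rmorphM /= !mulrA.
rewrite (gram_horner_alg _ D) -[_ * 'X]mulrA.
have -> : horner_mx (gram phi al be 1) (g * 'X * (g * 'X)) =
    horner_mx (gram phi al be 1) (g * 'X).
  apply/eqP; rewrite -subr_eq0 -rmorphB; set f := g * 'X in dvd *.
  rewrite (_ : f * f - f = - (f * (1 - f))); last by ring.
  move/dvdpP: dvd => [q ->].
  by rewrite rmorphN rmorphM /= Cayley_Hamilton mulr0 oppr0.
rewrite (trace_horner_mx _ sE).
transitivity (\sum_(z <- s) ((z == l)%:R : C)).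
  by rewrite big_seq [RHS]big_seq; apply: eq_bigr => z /ev.
rewrite -sum1_count natr_sum [RHS]big_mkcond; apply: eq_bigr => z _ /=.
by case: (z == l).
Qed.

End CommonTrace.

(** * Rank and multiplicity through Gram matrices *)

Section Counting.
Variable R : realType.

Lemma counting_seq (T : choiceType) (s : seq T) :
  uniq s -> counting [set` s] = (size s)%:R%:E :> \bar R.
Proof.
move=> us; rewrite /counting; case: asboolP => [_|[]//].
have -> : [set` s] = [set` [fset x in s]%fset].
  by apply/seteqP; split=> x /=; rewrite inE.
by rewrite set_fsetK card_fseq undup_id.
Qed.

End Counting.

Section Multiplicity.
Variables (R : realType) (A : banachAlgType (Cplx R)).
Let C : numClosedFieldType := R[i].
Hypothesis sp : @semiprime C A.
Variables (E : seq A) (phi : A -> C).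
Hypothesis fr : @frame C A E phi.
Variables (a : A) (n : nat) (al be r : 'I_n -> A).
Hypothesis D : @decomposition C A E a n al be r.
Hypothesis minD : forall m (al' be' r' : 'I_m -> A),
  @decomposition C A E a m al' be' r' -> (n <= m)%N.

Let M x : 'M[C]_n := @gram C A phi n al be x.

Let rootsM x := s2val (char_poly_roots (M x)).

Let rootsME x : char_poly (M x) = \prod_(z <- rootsM x) ('X - z%:P).
Proof. exact: (s2valP (char_poly_roots (M x))). Qed.

Let size_rootsM x : size (rootsM x) = n.
Proof. exact: (s2valP' (char_poly_roots (M x))). Qed.

Lemma mem_spectrum x (z : C) : z != 0 -> spectrum (x * a) z <-> z \in rootsM x.
Proof.
move=> z0; rewrite -root_prod_XsubC -rootsME.
exact: (@spectrum_gramP C A E phi fr a n al be r D x z z0).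
Qed.

Lemma counting_nzspectrum x :
  counting (nzspectrum (x * a)) =
  (size (undup [seq z <- rootsM x | z != 0]))%:R%:E :> \bar R.
Proof.
rewrite -counting_seq ?undup_uniq //; congr counting; apply/seteqP; split=> z /=.
  move=> [sz /eqP z0]; rewrite mem_undup mem_filter z0.
  exact/(mem_spectrum x z0).
rewrite mem_undup mem_filter => /andP[z0 zr]; split; last exact/eqP.
exact/(mem_spectrum x z0).
Qed.

Lemma size_nonzero_roots x :
  (size (undup [seq z <- rootsM x | z != 0%R]) <= n)%N.
Proof.
rewrite (leq_trans (size_undup _)) // size_filter.
by rewrite (leq_trans (count_size _ _)) // size_rootsM.
Qed.

Lemma simple_spectrum_size x :
  simple_spectrum (M x) = (size (undup [seq z <- rootsM x | z != 0]) == n).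
Proof.
rewrite (simple_spectrumP (rootsME x)); apply/idP/eqP => [/andP[us n0]|sz].
  have /all_filterP-> : all (fun z => z != 0) (rootsM x).
    by apply/allP => z; apply: contraTneq => ->.
  by rewrite undup_id.
have fE : [seq z <- rootsM x | z != 0] = rootsM x.
  apply/all_filterP; rewrite all_count eqn_leq count_size /= size_rootsM -{1}sz.
  by rewrite (leq_trans (size_undup _)) // size_filter.
rewrite fE in sz; apply/andP; split.
  by rewrite -[uniq _]negbK -ltn_size_undup sz size_rootsM ltnn.
by rewrite -fE mem_filter eqxx.
Qed.

(** Each gram x has n eigenvalues, and gram_simple provides one for which they
    are distinct and nonzero. *)
Lemma rank_gram : rank a = n%:R%:E.
Proof.
apply/eqP; rewrite eq_le; apply/andP; split.
  apply: ge_ereal_sup => _ [x _ <-].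
  by rewrite counting_nzspectrum lee_fin ler_nat size_nonzero_roots.
apply: ereal_sup_ubound.
have [x] := @gram_simple C A sp E phi fr a n al be r D minD.
rewrite -[gram _ _ _ _]/(M x) simple_spectrum_size => /eqP sz.
by exists x => //; rewrite counting_nzspectrum sz.
Qed.

Lemma Eset_gram x : Eset a x <-> simple_spectrum (M x).
Proof.
rewrite /Eset /= rank_gram counting_nzspectrum simple_spectrum_size.
by split=> [[/eqP]|/eqP->//]; rewrite eqr_nat.
Qed.

Lemma roots1_spectrum (z : C) : z \in rootsM 1 -> spectrum a z.
Proof.
rewrite -root_prod_XsubC -rootsME.
exact: (@gram1_root_spectrum C A sp E phi fr a n al be r D minD z).
Qed.

(** On E(a) near 1, the points of the spectrum in the disk are simple
    eigenvalues of gram x, and count_roots_near says how many there are. *)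
Lemma is_multiplicity_gram (l : C) : l != 0 ->
  is_multiplicity l a (count_mem l (rootsM 1)).
Proof.
move=> l0 e e0 iso.
have cvgM1 : coef_cvg (nbhs (1 : A)) (fun x => \prod_(z <- rootsM x) ('X - z%:P))
    (\prod_(z <- rootsM 1) ('X - z%:P)).
  rewrite -rootsME; under [X in coef_cvg _ X]eq_fun do rewrite -rootsME.
  by apply: coef_cvg_char_poly => i j; exact: (gram_cvg fr).
have near1 := @count_roots_near C A (nbhs (1 : A)) _ (rootsM 1) rootsM l e e0
  (fun x => etrans (size_rootsM x) (esym (size_rootsM 1))) cvgM1.
have /near1/nbhs_ballP[d d0 dP] :
    forall z, z \in rootsM 1 -> closure (ball l e) z -> z = l.
  by move=> z /roots1_spectrum sz cz; apply: iso.
exists d => // x [/Eset_gram simx /dP <-].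
have /andP[us n0] : uniq (rootsM x) && (0 \notin rootsM x).
  by rewrite -(simple_spectrumP (rootsME x)).
rewrite -size_filter -counting_seq ?filter_uniq //; congr counting.
apply/seteqP; split=> z /=.
  move=> [sz bz]; rewrite mem_filter; apply/andP; split; first exact/asboolP.
  apply/mem_spectrum => //; apply: contraTneq isT => z0.
  rewrite z0 in sz bz; have s0 : spectrum a 0.
    exact: (@simple_spectrum0 C A E phi fr a n al be r D x simx sz).
  have : 0 = l by apply: iso; split=> //; exact: subset_closure.
  by move/esym/eqP; rewrite (negbTE l0).
rewrite mem_filter => /andP[/asboolP bz zr]; split=> //.
by apply/mem_spectrum => //; apply: contraNneq n0 => <-.
Qed.

(** The segment from 1 to a point of E(a) meets E(a) arbitrarily close to 1, so
    both values are taken at a common point. *)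
Lemma is_multiplicity_unique (l : C) m m' :
  is_multiplicity l a m -> is_multiplicity l a m' -> m = m'.
Proof.
move=> hm hm'; have [e e0 eP] := isolating_radius (0 :: rootsM 1) l.
have iso : closure (ball l e) `&` spectrum a `<=` [set l].
  move=> z [cz sz]; apply: eP => //; rewrite inE; have [//|z0] := eqVneq z 0.
  by apply/(mem_spectrum 1 z0); rewrite mul1r.
have [d d0 dP] := hm e e0 iso; have [d' d'0 d'P] := hm' e e0 iso.
have [x0 simx0] := @gram_simple C A sp E phi fr a n al be r D minD.
pose L := `|x0 - 1| + 1 : C.
have L0 : 0 < L by rewrite ltr_wpDl.
have near1 k : 0 < k -> forall s : C, `|s| < k / L ->
    ball (1 : A) k (1 + s *: (x0 - 1)).
  move=> k0 s sk; rewrite -ball_normE /= opprD addrA subrr sub0r normrN normrZ.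
  apply: (@le_lt_trans _ _ (`|s| * L)); last by rewrite -ltr_pdivlMr.
  by rewrite ler_wpM2l // ler_wpDr.
have [k k0 [kd kd']] : exists2 k : C, 0 < k & k <= d / L /\ k <= d' / L.
  have dL : 0 < d / L by rewrite divr_gt0.
  have d'L : 0 < d' / L by rewrite divr_gt0.
  have /orP[le|le] : (d / L <= d' / L) || (d' / L <= d / L).
    by apply: real_leVge; rewrite gtr0_real.
  - by exists (d / L).
  - by exists (d' / L).
have [s sk] := simple_spectrum_perturb (M 1) k0 simx0.
have -> : M 1 + s *: (gram phi al be x0 - M 1) = M (1 + s *: (x0 - 1)).
  have glin := @gram_lin C A E phi fr n al be.
  have -> : 1 + s *: (x0 - 1) = s *: x0 + (1 - s) *: 1.
    by rewrite scalerBr scalerBl scale1r addrCA.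
  have M0 : M 0 = 0.
    by apply/matrixP => i j; rewrite !mxE mulr0 mul0r (frame0 fr).
  have -> : M (s *: x0 + (1 - s) *: 1) = s *: M x0 + M ((1 - s) *: 1) := glin _ _ _.
  have : M ((1 - s) *: 1 + 0) = (1 - s) *: M 1 + M 0 := glin _ _ _.
  rewrite !addr0 M0 addr0 => ->.
  by rewrite scalerBr scalerBl scale1r addrCA.
move/Eset_gram => Ex; have skd := lt_le_trans sk kd.
have skd' := lt_le_trans sk kd'.
have := d'P _ (conj Ex (near1 _ d'0 _ skd')).
rewrite (dP _ (conj Ex (near1 _ d0 _ skd))) => -[/eqP].
by rewrite eqr_nat => /eqP.
Qed.

Lemma multiplicity_gram (l : C) : l != 0 ->
  multiplicity l a = count_mem l (rootsM 1).
Proof.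
move=> l0; apply: get_unique; first exact: is_multiplicity_gram.
by move=> m hm; apply: is_multiplicity_unique hm (is_multiplicity_gram l0).
Qed.

Lemma nzspectrum_gram (l : C) : l != 0 ->
  spectrum a l <-> (0 < count_mem l (rootsM 1%R))%N.
Proof.
by move=> l0; rewrite -has_count has_pred1 -(mem_spectrum 1 l0) mul1r.
Qed.

End Multiplicity.

Lemma minimal_decomposition (C : numClosedFieldType) (A : banachAlgType C)
    (E : seq A) (a : A) :
  (exists n (al be r : 'I_n -> A), decomposition E a al be r) ->
  exists n (al be r : 'I_n -> A), decomposition E a al be r /\
    forall m (al' be' r' : 'I_m -> A), decomposition E a al' be' r' -> (n <= m)%N.
Proof.
move=> [n0 D0].
pose P n := `[< exists al be r : 'I_n -> A, decomposition E a al be r >].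
have exP : exists n, P n by exists n0; apply/asboolP.
case: (ex_minnP exP) => n /asboolP[al [be [r D]]] minn.
exists n, al, be, r; split=> // m al' be' r' D'; apply: minn.
by apply/asboolP; exists al', be', r'.
Qed.

(** Algebraic multiplicities for a and for b are traces of Gram matrices of
    decompositions of the same idempotent f(a) = f(b). *)
Lemma count_roots_eq (C : numClosedFieldType) (A : banachAlgType C) (E : seq A)
    (phi : A -> C) (a b : A) n (al be r : 'I_n -> A) n' (al' be' r' : 'I_n' -> A)
    (s s' : seq C) (l : C) :
  no_product_eigenvector a b ->
  frame E phi -> decomposition E a al be r -> decomposition E b al' be' r' ->
  char_poly (gram phi al be 1) = \prod_(z <- s) ('X - z%:P) ->
  char_poly (gram phi al' be' 1) = \prod_(z <- s') ('X - z%:P) ->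
  l != 0 -> count_mem l s = count_mem l s'.
Proof.
(* The root 0 is added so that f vanishes at 0, hence f = g X and f(a) is
   g(a) a. *)
move=> no_eigen fr D D' sE s'E l0; pose t := 0 :: (s ++ s').
have tE : \prod_(z <- t) ('X - z%:P) =
    char_poly (gram phi al be 1) * char_poly (gram phi al' be' 1) * 'X.
  by rewrite big_cons big_cat -sE -s'E polyC0 subr0 mulrC.
have [f [d1 d2 d3]] := spectral_poly t l.
have ev z : z \in t -> f.[z] = (z == l)%:R := spectral_poly_eval d1 d2.
have /factor_theorem[g fE] : root f 0.
  by rewrite rootE ev ?mem_head // [0 == l]eq_sym (negbTE l0).
rewrite polyC0 subr0 in fE.
have ann_a : horner_alg a (\prod_(z <- t) ('X - z%:P)) = 0.
  by rewrite tE mulrAC rmorphM /= (char_poly_annihilates fr D) mul0r.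
have ann_b : horner_alg b (\prod_(z <- t) ('X - z%:P)) = 0.
  by rewrite tE -mulrA rmorphM /= (char_poly_annihilates fr D') mulr0.
have fab := spectral_idempotent_eq no_eigen ann_a ann_b d1 d2.
have pE x : horner_alg x g * x = horner_alg x f.
  by rewrite fE rmorphM /= horner_algX.
have Dp := decomposition_mull (horner_alg a g) D.
have Dp' := decomposition_mull (horner_alg b g) D'.
rewrite pE in Dp; rewrite pE -fab in Dp'.
have dvd_t q : q %| \prod_(z <- t) ('X - z%:P) -> q %| f * (1 - f).
  by move=> /dvdp_trans; apply.
apply/eqP; rewrite -(eqr_nat C); apply/eqP.
rewrite -(trace_spectral_idempotent fr D (l := l) (g := g) sE) -?fE; last 2 first.
- by apply: dvd_t; rewrite tE -mulrA dvdp_mulr.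
- by move=> z zs; apply: ev; rewrite inE mem_cat zs orbT.
rewrite -(trace_spectral_idempotent fr D' (l := l) (g := g) s'E) -?fE; last 2 first.
- by apply: dvd_t; rewrite tE mulrAC dvdp_mull.
- by move=> z zs; apply: ev; rewrite inE mem_cat zs !orbT.
by rewrite -fab; exact: trace_gram_unique fr _ _ _ _ _ _ _ _ _ Dp Dp'.
Qed.

Theorem corollary3p6 (R : realType) (A : banachAlgType (Cplx R)) (a b : A)
    (ss_A : semisimple A) (soc_a : socle a) (soc_b : socle b)
    (rho_ab : rho a b = 0%E) :
  nzspectrum a = nzspectrum b /\
  forall l : Cplx R, nzspectrum a l -> multiplicity l a = multiplicity l b.
Proof.
pose C : numClosedFieldType := R[i].
have sp : @semiprime C A := @semisimple_semiprime C A ss_A.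
have [sa sa1 aE] := soc_a; have [sb sb1 bE] := soc_b.
have [|E [uE orthE coverE]] := @orthogonal_idempotents_cover C A sp (sa ++ sb).
  by move=> u; rewrite mem_cat => /orP[/sa1|/sb1].
have fr := @frame_exists C A E uE orthE; set phi := (fun x => _) in fr.
have [|na [ala [bea [ra [Da mina]]]]] := @minimal_decomposition C A E a.
  rewrite aE; apply: (@decomposition_exists C A) => // u us; apply: coverE.
  by rewrite mem_cat us.
have [|nb [alb [beb [rb [Db minb]]]]] := @minimal_decomposition C A E b.
  rewrite bE; apply: (@decomposition_exists C A) => // u us; apply: coverE.
  by rewrite mem_cat us orbT.
have count_eq (l : C) : l != 0 -> _ :=
  @count_roots_eq C A E phi a b _ _ _ _ _ _ _ _ _ _ l (rho0_no_eigen rho_ab)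
    fr Da Db (s2valP (char_poly_roots _)) (s2valP (char_poly_roots _)).
split.
  apply/seteqP; split=> l [sl /eqP l0]; split; try exact/eqP.
    apply/(nzspectrum_gram fr Db l0); rewrite -count_eq //.
    exact/(nzspectrum_gram fr Da l0).
  apply/(nzspectrum_gram fr Da l0); rewrite count_eq //.
  exact/(nzspectrum_gram fr Db l0).
move=> l [_ /eqP l0].
rewrite (multiplicity_gram sp fr Da mina l0) (multiplicity_gram sp fr Db minb l0).
exact: count_eq.
Qed.
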